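(* Let $F=\sum_{k=1}^Na_kG_k$ with real coefficients $a_1,\dots,a_N$ (not necessarily positive), and let $\mathcal{F}(p_0,\dots,p_3)=\sum_{k=1}^Na_k\mathcal{E}_k(p_0,\dots,p_3)$. For every good block $B$, $$\min_{v\in\langle B\rangle}\mathcal{F}(v)\ge\min_{v\in B}\mathcal{F}(v)-\mathbf{ERR}_F(B),\qquad \mathbf{ERR}_F(B)=\sum_{k=1}^N|a_k|\,\mathbf{ERR}_k(B).$$
   Context: Stereographic projection $\Sigma(x,y,z)=(x/(1-z),y/(1-z))$, $\Sigma(0,0,1)=\infty$; $\widehat p=\Sigma^{-1}(p)$. $G_k(p,q)=(4-\|\widehat p-\widehat q\|^2)^k$. Dyadic segments: segments of the $x$-axis obtained from $[0,4]\times\{0\}$ by repeated bisection. Dyadic squares: obtained from $[-2,2]^2$ by repeated quartering; good if contained in $[-3/2,3/2]^2$ with side length $\le1/2$. $Q$ also denotes its vertex set, $\langle Q\rangle$ its convex hull, $\widehat Q=\Sigma^{-1}(Q)$, $\langle\widehat Q\rangle$ the convex hull of $\widehat Q$ in $\mathbb{R}^3$. $d(Q)$ = diameter of $\langle\widehat Q\rangle$; $d_1(Q)$ = longest edge length of $\langle\widehat Q\rangle$; $D_Q$ = smallest closed disk in $\mathbb{R}^2$ whose boundary contains $Q$, $d_2(Q)$ = Euclidean diameter of $\Sigma^{-1}(D_Q)$. $\chi(D,d)=\frac{d^2}{4D}+\frac{d^4}{2D^3}$; $\delta(Q)=\chi(2,d_2)$ for segments, $\max(\chi(1,d_1),\chi(2,d_2))$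 for good squares; $d(\{\infty\})=\delta(\{\infty\})=0$. $(Q\cdot Q')_{\max}=\max_{i,j}\widehat q_i\cdot\widehat q'_j+\delta(Q)+\delta(Q')+\delta(Q)\delta(Q')$; $(Q\cdot\{\infty\})_{\max}=\max_i\widehat q_i\cdot(0,0,1)$. $T=2+2(Q\cdot Q')_{\max}$; $\epsilon_k(Q,Q')=\frac12k(k-1)T^{k-2}d(Q)^2+2kT^{k-1}\delta(Q)$, $\epsilon_k(\{\infty\},Q')=0$. A good block is $B=(Q_0,\dots,Q_3)$, $Q_0$ a dyadic segment, $Q_1,Q_2,Q_3$ good dyadic squares; $Q_4=\{\infty\}$. $\langle B\rangle=\{(p_0,\dots,p_3):p_i\in\langle Q_i\rangle\}$; $B$ also denotes the vertex configurations ($p_i\in Q_i$). $\mathcal{E}_k(p_0,\dots,p_3)=\sum_{0\le i<j\le4}G_k(p_i,p_j)$ with $p_4=\infty$; $\mathbf{ERR}_k(B)=\sum_{i=0}^3\sum_{j\le4,\,j\ne i}\epsilon_k(Q_i,Q_j)$. *)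

(* Defs.v *)
From HB Require Import structures.
From mathcomp Require Import all_boot all_order all_algebra.
From mathcomp Require Import boolp classical_sets reals.
Set Implicit Arguments. Unset Strict Implicit. Unset Printing Implicit Defensive.
Import Order.TTheory GRing.Theory Num.Theory.
Local Open Scope ring_scope.
Local Open Scope classical_set_scope.

Section Defs.
Variable R : realType.

Definition dot n (u v : 'rV[R]_n) : R := \sum_(i < n) u 0 i * v 0 i.
Definition dist n (u v : 'rV[R]_n) : R := Num.sqrt (dot (u - v) (u - v)).

Definition conv n (S : seq 'rV[R]_n) : set 'rV[R]_n :=
  [set x | exists lam : 'I_(size S) -> R,
     (forall i, 0 <= lam i) /\ \sum_(i < size S) lam i = 1 /\
     x = \sum_(i < size S) lam i *: nth 0 S i].

Definition diam n (A : set 'rV[R]_n) : R :=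
  sup [set r | exists x y, A x /\ A y /\ r = dist x y].

(** edges (one-dimensional exposed faces) of the polytope conv S *)
Definition is_edge n (S : seq 'rV[R]_n) (u v : 'rV[R]_n) : Prop :=
  u \in S /\ v \in S /\ u != v /\
  exists (w : 'rV[R]_n) (c : R),
    (forall x, conv S x -> dot w x <= c) /\
    (forall x, (conv S x /\ dot w x = c) <-> conv [:: u; v] x).

Definition longest_edge n (S : seq 'rV[R]_n) : R :=
  sup [set r | exists u v, is_edge S u v /\ r = dist u v].

Definition mk2 (a b : R) : 'rV[R]_2 := \row_(i < 2) nth 0 [:: a; b] i.
Definition mk3 (a b c : R) : 'rV[R]_3 := \row_(i < 3) nth 0 [:: a; b; c] i.

(** Points of the extended plane R^2 u {oo}: [None] is oo. *)
Definition ept := option 'rV[R]_2.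

(** Stereographic projection Sigma(x,y,z) = (x/(1-z), y/(1-z)) and its
    inverse (the explicit formula), Sigma^{-1}(oo) = (0,0,1). *)
Definition sigma (P : 'rV[R]_3) : ept :=
  if P 0 2%:R == 1 then None
  else Some (mk2 (P 0 0 / (1 - P 0 2%:R)) (P 0 1 / (1 - P 0 2%:R))).

Definition sigma_inv_pt (p : 'rV[R]_2) : 'rV[R]_3 :=
  let s := dot p p in
  mk3 (2 * p 0 0 / (1 + s)) (2 * p 0 1 / (1 + s)) ((s - 1) / (s + 1)).

Definition hat (p : ept) : 'rV[R]_3 :=
  match p with Some q => sigma_inv_pt q | None => mk3 0 0 1 end.

Definition G (k : nat) (p q : ept) : R := (4 - dist (hat p) (hat q) ^+ 2) ^+ k.

(** Dyadic segments [a,b] x {0}, obtained from [0,4] x {0} by repeated bisection. *)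
Inductive dyadic_segment : R -> R -> Prop :=
| dseg_base : dyadic_segment 0 4
| dseg_left a b : dyadic_segment a b -> dyadic_segment a ((a + b) / 2)
| dseg_right a b : dyadic_segment a b -> dyadic_segment ((a + b) / 2) b.

(** Dyadic squares [x, x+s] x [y, y+s], obtained from [-2,2]^2 by repeated
    quartering. *)
Inductive dyadic_square : R -> R -> R -> Prop :=
| dsq_base : dyadic_square (-2) (-2) 4
| dsq_quarter x y s (i j : bool) : dyadic_square x y s ->
    dyadic_square (x + (i%:R) * (s / 2)) (y + (j%:R) * (s / 2)) (s / 2).

Definition good_square (x y s : R) : Prop :=
  dyadic_square x y s /\ s <= 1 / 2 /\
  - (3 / 2) <= x /\ x + s <= 3 / 2 /\ - (3 / 2) <= y /\ y + s <= 3 / 2.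

(** The pieces Q: a segment [a,b] x {0}, a square [x,x+s] x [y,y+s], or {oo}. *)
Inductive piece := Seg of R & R | Sq of R & R & R | Inf.

Definition verts (Q : piece) : seq 'rV[R]_2 :=
  match Q with
  | Seg a b => [:: mk2 a 0; mk2 b 0]
  | Sq x y s => [:: mk2 x y; mk2 (x + s) y; mk2 (x + s) (y + s); mk2 x (y + s)]
  | Inf => [::]
  end.

Definition everts (Q : piece) : seq ept :=
  match Q with Inf => [:: None] | _ => map Some (verts Q) end.

Definition hatQ (Q : piece) : seq 'rV[R]_3 := map hat (everts Q).

Definition dQ (Q : piece) : R :=
  match Q with Inf => 0 | _ => diam (conv (hatQ Q)) end.

Definition d1 (Q : piece) : R := longest_edge (hatQ Q).

Definition disk_through (Q : piece) (cr : 'rV[R]_2 * R) : Prop :=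
  0 <= cr.2 /\ forall q, q \in verts Q -> dist q cr.1 = cr.2.
Definition smallest_disk (Q : piece) (cr : 'rV[R]_2 * R) : Prop :=
  disk_through Q cr /\ forall cr', disk_through Q cr' -> cr.2 <= cr'.2.
Definition DQ (Q : piece) : 'rV[R]_2 * R := xget (0, 0) (smallest_disk Q).
Definition closed_disk (cr : 'rV[R]_2 * R) : set 'rV[R]_2 :=
  [set p | dist p cr.1 <= cr.2].

Definition d2 (Q : piece) : R :=
  diam (sigma_inv_pt @` closed_disk (DQ Q)).

Definition chi (D d : R) : R := d ^+ 2 / (4 * D) + d ^+ 4 / (2 * D ^+ 3).

Definition delta (Q : piece) : R :=
  match Q with
  | Seg _ _ => chi 2 (d2 Q)
  | Sq _ _ _ => Num.max (chi 1 (d1 Q)) (chi 2 (d2 Q))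
  | Inf => 0
  end.

Definition maxl (s : seq R) : R := foldr Num.max (head 0 s) s.

Definition dotmax (Q Q' : piece) : R :=
  match Q' with
  | Inf => maxl [seq dot q (mk3 0 0 1) | q <- hatQ Q]
  | _ => maxl [seq dot q q' | q <- hatQ Q, q' <- hatQ Q']
         + delta Q + delta Q' + delta Q * delta Q'
  end.

Definition eps (k : nat) (Q Q' : piece) : R :=
  match Q with
  | Inf => 0
  | _ => let T := 2 + 2 * dotmax Q Q' in
         (k * (k - 1))%N%:R / 2 * T ^+ (k - 2) * dQ Q ^+ 2
         + 2 * k%:R * T ^+ (k - 1) * delta Q
  end.

Definition good_block (B : piece * piece * piece * piece) : Prop :=
  let: (Q0, Q1, Q2, Q3) := B in
  (exists a b, Q0 = Seg a b /\ dyadic_segment a b) /\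
  (forall Q, Q = Q1 \/ Q = Q2 \/ Q = Q3 ->
     exists x y s, Q = Sq x y s /\ good_square x y s).

Definition blist (B : piece * piece * piece * piece) : seq piece :=
  let: (Q0, Q1, Q2, Q3) := B in [:: Q0; Q1; Q2; Q3; Inf].

Definition config := ('rV[R]_2 * 'rV[R]_2 * 'rV[R]_2 * 'rV[R]_2)%type.

Definition cpts (v : config) : seq ept :=
  let: (p0, p1, p2, p3) := v in [:: Some p0; Some p1; Some p2; Some p3; None].

Definition Ek (k : nat) (v : config) : R :=
  \sum_(i < 5) \sum_(j < 5 | (i < j)%N)
     G k (nth None (cpts v) i) (nth None (cpts v) j).

Definition ERRk (k : nat) (B : piece * piece * piece * piece) : R :=
  \sum_(i < 4) \sum_(j < 5 | (j : nat) != i)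
     eps k (nth Inf (blist B) i) (nth Inf (blist B) j).

Definition in_hull_block (B : piece * piece * piece * piece) (v : config) : Prop :=
  let: (Q0, Q1, Q2, Q3) := B in
  let: (p0, p1, p2, p3) := v in
  conv (verts Q0) p0 /\ conv (verts Q1) p1 /\ conv (verts Q2) p2 /\ conv (verts Q3) p3.

Definition vertex_configs (B : piece * piece * piece * piece) : seq config :=
  let: (Q0, Q1, Q2, Q3) := B in
  [seq (p01.1, p23.1, p23.2.1, p23.2.2)
   | p01 <- [seq (p0, tt) | p0 <- verts Q0],
     p23 <- [seq (p1, p23) | p1 <- verts Q1,
               p23 <- [seq (p2, p3) | p2 <- verts Q2, p3 <- verts Q3]]].

Definition minl (s : seq R) : R := foldr Num.min (head 0 s) s.

End Defs.

(* Main.v *)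
Require Import Defs.
From HB Require Import structures.
From mathcomp Require Import all_boot all_order all_algebra.
From mathcomp Require Import boolp classical_sets reals ring lra.
Import Order.TTheory GRing.Theory Num.Theory.
Local Open Scope ring_scope.
Set Implicit Arguments. Unset Strict Implicit. Unset Printing Implicit Defensive.

(** On the unit sphere G_k(p,q) = (2 + 2 X.Y)^k with X, Y the images of p, q.

    Interpolation. If X is within delta(Q) of X* = sum_i l_i X_i, a convex
    combination of the images of the vertices of Q, then G_k(p,q) differs from
    sum_i l_i G_k(q_i,q) by at most epsilon_k(Q,Q'): the term in delta is the mean
    value bound between X and X*, the term in d(Q)^2 is the Jensen gap, estimated by
    Taylor's formula and Popoviciu's variance bound. The weights do not depend on q
    nor on k, so p may be replaced by some vertex of Q at the cost of
    sum_k |a_k| sum_j epsilon_k(Q,Q_j). Doing this for the four points in turn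
    proves the theorem.

    Hull approximation. The vertices of Q lie on a circle, so their images span a
    plane that cuts off a cap of the sphere of diameter at most d_2(Q). The radial
    projection of X to that plane moves X by at most the height of the cap, which
    is at most chi(2,d_2). If the projection falls outside the hull of the images, as
    may happen for squares, then X lies between the planes that join some edge of the
    hull to the origin and to the pole. All planes in that wedge cut the sphere in
    circles of diameter greater than 1 and X is within d_1^2/4 of the edge. *)

(** * Euclidean geometry and convex hulls *)

Section Euclid.
Variable R : realType.
Implicit Types n : nat.

Lemma dotC n (u v : 'rV[R]_n) : dot u v = dot v u.
Proof. by apply: eq_bigr => i _; rewrite mulrC. Qed.

Lemma dotDl n (u v w : 'rV[R]_n) : dot (u + v) w = dot u w + dot v w.
Proof. by rewrite -big_split; apply: eq_bigr => i _; rewrite !mxE mulrDl. Qed.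

Lemma dotZl n (c : R) (u w : 'rV[R]_n) : dot (c *: u) w = c * dot u w.
Proof. by rewrite mulr_sumr; apply: eq_bigr => i _; rewrite !mxE mulrA. Qed.

Lemma dotDr n (u v w : 'rV[R]_n) : dot w (u + v) = dot w u + dot w v.
Proof. by rewrite dotC dotDl !(dotC w). Qed.

Lemma dotZr n (c : R) (u w : 'rV[R]_n) : dot w (c *: u) = c * dot w u.
Proof. by rewrite dotC dotZl (dotC w). Qed.

Lemma dotNl n (u w : 'rV[R]_n) : dot (- u) w = - dot u w.
Proof. by rewrite -scaleN1r dotZl mulN1r. Qed.

Lemma dotNr n (u w : 'rV[R]_n) : dot w (- u) = - dot w u.
Proof. by rewrite -scaleN1r dotZr mulN1r. Qed.

Definition dotE := (dotDl, dotDr, dotNl, dotNr, dotZl, dotZr).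

Lemma dot_suml n (I : finType) (F : I -> 'rV[R]_n) w :
  dot (\sum_i F i) w = \sum_i dot (F i) w.
Proof.
rewrite /dot exchange_big; apply: eq_bigr => i _.
by rewrite summxE mulr_suml.
Qed.

Lemma dot_ge0 n (u : 'rV[R]_n) : 0 <= dot u u.
Proof. by apply: sumr_ge0 => i _; rewrite -expr2 sqr_ge0. Qed.

Definition nrm n (u : 'rV[R]_n) : R := Num.sqrt (dot u u).

Lemma nrm_ge0 n (u : 'rV[R]_n) : 0 <= nrm u.
Proof. exact: sqrtr_ge0. Qed.

Lemma sqr_nrm n (u : 'rV[R]_n) : nrm u ^+ 2 = dot u u.
Proof. by rewrite sqr_sqrtr ?dot_ge0. Qed.

Lemma cauchy_schwarz_sqr n (u v : 'rV[R]_n) :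
  dot u v ^+ 2 <= dot u u * dot v v.
Proof.
have [v0|v0] := eqVneq (dot v v) 0.
  have H : forall t : R, 0 <= dot u u + 2 * t * dot u v.
    move=> t; have := dot_ge0 (u + t *: v).
    by rewrite !dotE v0 (dotC v u) => h; nra.
  have [->|uv0] := eqVneq (dot u v) 0; first by rewrite v0; lra.
  (* At this [t] the affine function in [H] would take the value -1. *)
  have := H (- (dot u u + 1) / (2 * dot u v)).
  have -> : 2 * (- (dot u u + 1) / (2 * dot u v)) * dot u v = - (dot u u + 1).
    by field.
  lra.
have vp : 0 < dot v v by rewrite lt_def v0 dot_ge0.
have := dot_ge0 (dot v v *: u - dot u v *: v).
rewrite !dotE (dotC v u) => h.
have : 0 <= dot v v * (dot u u * dot v v - dot u v ^+ 2) by nra.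
by rewrite pmulr_rge0 // subr_ge0.
Qed.

Lemma cauchy_schwarz n (u v : 'rV[R]_n) : `|dot u v| <= nrm u * nrm v.
Proof.
rewrite -(@ler_pXn2r _ 2) ?nnegrE ?mulr_ge0 ?nrm_ge0 //.
by rewrite exprMn !sqr_nrm real_normK ?num_real // cauchy_schwarz_sqr.
Qed.

Lemma nrmD n (u v : 'rV[R]_n) : nrm (u + v) <= nrm u + nrm v.
Proof.
rewrite -(@ler_pXn2r _ 2) ?nnegrE ?addr_ge0 ?nrm_ge0 //.
rewrite sqr_nrm !dotE (dotC v u) -!sqr_nrm.
have := le_trans (ler_norm _) (cauchy_schwarz u v); nra.
Qed.

Lemma nrmZ n (c : R) (u : 'rV[R]_n) : nrm (c *: u) = `|c| * nrm u.
Proof. by rewrite /nrm !dotE mulrA -expr2 sqrtrM ?sqr_ge0 // sqrtr_sqr. Qed.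

Lemma nrmN n (u : 'rV[R]_n) : nrm (- u) = nrm u.
Proof. by rewrite /nrm !dotE opprK. Qed.

Lemma nrm_le n (u : 'rV[R]_n) (c : R) : 0 <= c -> dot u u <= c ^+ 2 -> nrm u <= c.
Proof. by move=> c0 h; rewrite -(@ler_pXn2r _ 2) ?nnegrE ?nrm_ge0 // sqr_nrm. Qed.

Lemma conv_dot_le n (S : seq 'rV[R]_n) (w x : 'rV[R]_n) (m : R) :
  (forall q, q \in S -> dot q w <= m) -> conv S x -> dot x w <= m.
Proof.
move=> h [lam [l0 [l1 ->]]]; rewrite dot_suml -(mul1r m) -l1 mulr_suml.
by apply: ler_sum => i _; rewrite dotZl ler_wpM2l ?h ?mem_nth.
Qed.

(** The difference of the two sides is the weighted mean of |x_i - x|^2. *)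
Lemma sqnorm_mean_le n (S : seq 'rV[R]_n) (l : 'I_(size S) -> R) x :
  (forall i, 0 <= l i) -> \sum_i l i = 1 -> x = \sum_(i < size S) l i *: nth 0 S i ->
  dot x x <= \sum_(i < size S) l i * dot (nth 0 S i) (nth 0 S i).
Proof.
move=> l0 l1 xE.
have : 0 <= \sum_(i < size S) l i * dot (nth 0 S i - x) (nth 0 S i - x).
  by apply: sumr_ge0 => i _; rewrite mulr_ge0 ?dot_ge0.
have -> : \sum_(i < size S) l i * dot (nth 0 S i - x) (nth 0 S i - x) =
    \sum_(i < size S) (l i * dot (nth 0 S i) (nth 0 S i)
      - dot (l i *: nth 0 S i) (2 *: x) + l i * dot x x).
  apply: eq_bigr => i _; rewrite !dotE (dotC x (nth _ _ _)); ring.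
by rewrite big_split sumrB /= -dot_suml -xE -mulr_suml l1 dotZr; lra.
Qed.

Lemma conv_mem n (S : seq 'rV[R]_n) x : x \in S -> conv S x.
Proof.
move=> xS; have hi : (index x S < size S)%N by rewrite index_mem.
exists (fun i => (i == Ordinal hi)%:R); split; first by move=> i; rewrite ler0n.
split; rewrite (bigD1 (Ordinal hi)) //= eqxx big1 ?addr0 //.
- by move=> i /negPf ->.
- by rewrite scale1r nth_index.
- by move=> i /negPf ->; rewrite scale0r.
Qed.

Lemma conv_comb n (S : seq 'rV[R]_n) x y (t : R) : 0 <= t <= 1 ->
  conv S x -> conv S y -> conv S ((1 - t) *: x + t *: y).
Proof.
move=> /andP[t0 t1] [l [l0 [l1 ->]]] [k [k0 [k1 ->]]].
exists (fun i => (1 - t) * l i + t * k i); split.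
  by move=> i; rewrite addr_ge0 ?mulr_ge0 ?subr_ge0.
split; first by rewrite big_split /= -!mulr_sumr l1 k1 !mulr1 subrK.
rewrite !scaler_sumr -big_split; apply: eq_bigr => i _.
by rewrite /= !scalerA -scalerDl.
Qed.

Lemma conv_segP n (a b x : 'rV[R]_n) :
  conv [:: a; b] x <-> exists2 t : R, 0 <= t <= 1 & x = (1 - t) *: a + t *: b.
Proof.
split=> [[l [l0 []]]|[t t01 ->]].
  rewrite !big_ord_recl !big_ord0 /= => l1 ->.
  exists (l (lift ord0 ord0)).
    by rewrite l0 /=; have := l0 ord0; lra.
  rewrite addr0; congr (_ *: _ + _ *: _); lra.
by apply: conv_comb => //; apply: conv_mem; rewrite !inE eqxx ?orbT.
Qed.

Lemma conv_seg_sub n (S : seq 'rV[R]_n) a b x : a \in S -> b \in S ->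
  conv [:: a; b] x -> conv S x.
Proof. by move=> aS bS /conv_segP[t t01 ->]; apply: conv_comb => //; exact: conv_mem. Qed.

(** A convex combination on which [w] attains its maximum [c] gives no weight to points where [w] is
    below [c], so only [u] and [v] remain. *)
Lemma is_edge_support n (S : seq 'rV[R]_n) u v w (c : R) :
  u \in S -> v \in S -> u != v -> dot u w = c -> dot v w = c ->
  (forall q, q \in S -> q != u -> q != v -> dot q w < c) -> is_edge S u v.
Proof.
move=> uS vS uv wu wv H.
have Hle q : q \in S -> dot q w <= c.
  move=> qS; have [->|qu] := eqVneq q u; first by rewrite wu.
  by have [->|qv] := eqVneq q v; [rewrite wv|exact/ltW/H].
do 3!split=> //; exists w, c; split=> x; first by rewrite dotC; exact: conv_dot_le.
split=> [[[l [l0 [l1 ->]]]] wx|/conv_segP[t t01 ->]]; last first.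
  split; first by apply: conv_comb => //; exact: conv_mem.
  rewrite dotC !dotE wu wv; lra.
have Z (i : 'I_(size S)) : nth 0 S i != u -> nth 0 S i != v -> l i = 0.
  move=> iu iv.
  have hs : \sum_i l i * (c - dot (nth 0 S i) w) = 0.
    under eq_bigr do rewrite mulrBr.
    rewrite sumrB -mulr_suml l1 mul1r -[in X in X - _]wx dotC dot_suml.
    by under eq_bigr do rewrite dotZl; rewrite subrr.
  have hp j : true -> 0 <= l j * (c - dot (nth 0 S j) w).
    by move=> _; rewrite mulr_ge0 // subr_ge0 Hle ?mem_nth.
  have /(_ i isT)/eqP := psumr_eq0P hp hs.
  rewrite mulf_eq0 => /orP[/eqP //|/eqP h].
  by have := H _ (mem_nth 0 (ltn_ord i)) iu iv; lra.
(* [S] may list [u] or [v] several times, so sums are split by the value of the entry, not by its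
   index. *)
have split2 (V : zmodType) (f : 'I_(size S) -> V) :
    (forall i : 'I_(size S), nth 0 S i != u -> nth 0 S i != v -> f i = 0) ->
    \sum_i f i = \sum_(i < size S | nth 0 S i == u) f i + \sum_(i < size S | nth 0 S i == v) f i.
  move=> fz; rewrite (bigID (fun i : 'I_(size S) => nth 0 S i == u)) /=; congr (_ + _).
  rewrite (bigID (fun i : 'I_(size S) => nth 0 S i == v)) /= [X in _ + X]big1 ?addr0.
    apply: eq_bigl => i; case: (eqVneq _ v) => [->|_]; last by rewrite andbF.
    by rewrite andbT eq_sym.
  by move=> i /andP[]; exact: fz.
apply/conv_segP; exists (\sum_(i < size S | nth 0 S i == v) l i).
  rewrite sumr_ge0 //= -l1 split2 // lerDr sumr_ge0 //.
rewrite split2; last by move=> i iu iv; rewrite Z ?scale0r.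
rewrite -l1 split2 // addrK; congr (_ + _); rewrite scaler_suml;
  by apply: eq_bigr => i /eqP ->.
Qed.

(** A supremum is known to dominate its set once the set is bounded above; the norm bound [m]
    supplies this. *)
Lemma dist_le_diam n (A : set 'rV[R]_n) (m : R) x y :
  (forall z, A z -> nrm z <= m) -> A x -> A y -> dist x y <= diam A.
Proof.
move=> h Ax Ay; apply: sup_ubound; last by exists x, y.
exists (m + m) => _ [u [v [Au [Av ->]]]].
by apply: le_trans (nrmD _ _) _; rewrite nrmN lerD ?h.
Qed.

(** Pair with [x] itself: Cauchy-Schwarz bounds q.x by |x| for each q in [S], hence |x|^2 <= |x|. *)
Lemma conv_nrm_le n (S : seq 'rV[R]_n) x : (forall q, q \in S -> nrm q <= 1) ->
  conv S x -> nrm x <= 1.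
Proof.
move=> h xS; apply: nrm_le => //.
have : dot x x <= nrm x.
  apply: conv_dot_le xS => q qS; apply: le_trans (ler_norm _) _.
  by apply: le_trans (cauchy_schwarz _ _) _; rewrite ler_piMl ?nrm_ge0 ?h.
rewrite -sqr_nrm; have := nrm_ge0 x; nra.
Qed.

Lemma edge_le_longest n (S : seq 'rV[R]_n) u v :
  (forall q, q \in S -> nrm q <= 1) -> is_edge S u v -> dist u v <= longest_edge S.
Proof.
move=> h e; apply: sup_ubound; last by exists u, v.
exists (1 + 1) => _ [a [b [[aS [bS _]] ->]]].
by apply: le_trans (nrmD _ _) _; rewrite nrmN lerD ?h.
Qed.

End Euclid.

(** * Powers and weighted means *)

Section Energy.
Variable R : realType.

(** The quotient of x^k - y^k by x - y is a sum of k monomials of degree k - 1, each at most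
    T^(k-1). *)
Lemma pow_diff_le (T x y : R) k : 0 <= x <= T -> 0 <= y <= T ->
  `|x ^+ k - y ^+ k| <= k%:R * T ^+ (k - 1) * `|x - y|.
Proof.
move=> /andP[x0 xT] /andP[y0 yT]; have T0 := le_trans x0 xT.
rewrite subrXX normrM mulrC ler_wpM2r // ger0_norm; last first.
  by apply: sumr_ge0 => i _; rewrite mulr_ge0 ?exprn_ge0.
rewrite -[k%:R * _]mulrC mulr_natr -[X in _ *+ X]card_ord -sumr_const.
apply: ler_sum => i _; have ik : (k.-1 - i + i = k - 1)%N.
  by rewrite subn1 subnK // -ltnS (leq_trans (ltn_ord i)) // leqSpred.
rewrite -ik exprD; apply: ler_pM; rewrite ?exprn_ge0 //; apply: lerXn2r => //;
  by rewrite nnegrE.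
Qed.

(** Induction on [k]: the remainders satisfy r_(k+1) = y r_k + (k+1) m^k (y - m)^2, and both bounds
    pass through this recursion. *)
Lemma taylor2_pow (T y m : R) k : 0 <= y <= T -> 0 <= m <= T ->
  0 <= y ^+ k.+1 - m ^+ k.+1 - k.+1%:R * m ^+ k * (y - m)
    <= (k.+1 * k)%N%:R / 2 * T ^+ (k - 1) * (y - m) ^+ 2.
Proof.
move=> /andP[y0 yT] /andP[m0 mT]; have T0 := le_trans y0 yT.
elim: k => [|k /andP[IH0 IH]].
  by rewrite muln0 !expr1 expr0 !mul0r; apply/andP; split; lra.
have -> : y ^+ k.+2 - m ^+ k.+2 - k.+2%:R * m ^+ k.+1 * (y - m) =
    y * (y ^+ k.+1 - m ^+ k.+1 - k.+1%:R * m ^+ k * (y - m))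
    + k.+1%:R * m ^+ k * (y - m) ^+ 2.
  by rewrite (exprS y k.+1) (exprS m k.+1) (exprS m k) -!natr1; ring.
have mk0 : 0 <= m ^+ k by rewrite exprn_ge0.
have c0 : 0 <= k.+1%:R :> R by rewrite ler0n.
have s0 := sqr_ge0 (y - m).
apply/andP; split; first by apply: addr_ge0; apply: mulr_ge0 => //; exact: mulr_ge0.
have mTk : m ^+ k <= T ^+ k by apply: lerXn2r; rewrite ?nnegrE.
have h1 : y * (y ^+ k.+1 - m ^+ k.+1 - k.+1%:R * m ^+ k * (y - m)) <=
    T * ((k.+1 * k)%N%:R / 2 * T ^+ (k - 1) * (y - m) ^+ 2) by apply: ler_pM.
have h2 : k.+1%:R * m ^+ k * (y - m) ^+ 2 <= k.+1%:R * T ^+ k * (y - m) ^+ 2.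
  by rewrite ler_wpM2r // ler_wpM2l.
apply: le_trans (lerD h1 h2) _; rewrite subSS subn0 le_eqVlt; apply/orP; left.
(* [k - 1] truncates at k = 0, where the coefficient [k.+1 * k] vanishes. *)
apply/eqP; case: k {IH0 IH mk0 c0 mTk h1 h2} => [|k].
  rewrite muln0 !expr0 muln1; lra.
rewrite subSS subn0 !natrM -!natr1 (exprS T); by field.
Qed.

(** With u and v the extreme values, (u - y_i)(y_i - v) >= 0 bounds (y_i - m)^2 by an affine
    function of y_i. Its mean is (u - m)(m - v) <= ((u - v)/2)^2. *)
Lemma variance_le n (l y : 'I_n -> R) (d m : R) :
  (forall i, 0 <= l i) -> \sum_i l i = 1 -> m = \sum_i l i * y i ->
  (forall i j, `|y i - y j| <= 2 * d) ->
  \sum_i l i * (y i - m) ^+ 2 <= d ^+ 2.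
Proof.
case: n l y => [|n] l y l0 l1 mE hd.
  by move: l1; rewrite big_ord0 => /eqP; rewrite eq_sym oner_eq0.
pose i0 := [arg min_(i < ord0) y i]%O; pose i1 := [arg max_(i > ord0) y i]%O.
have hmin i : y i0 <= y i by rewrite /i0; case: arg_minP => // j _; exact.
have hmax i : y i <= y i1 by rewrite /i1; case: arg_maxP => // j _; exact.
have := ler_norm (y i1 - y i0); move/le_trans/(_ (hd _ _)).
set u := y i1 in hmax *; set v := y i0 in hmin * => uv.
have H : \sum_i l i * (y i - m) ^+ 2 <= \sum_i l i * ((u + v - 2 * m) * y i + (m ^+ 2 - u * v)).
  apply: ler_sum => i _; rewrite ler_wpM2l //.
  have := hmin i; have := hmax i; nra.
apply: le_trans H _.
have -> : \sum_i l i * ((u + v - 2 * m) * y i + (m ^+ 2 - u * v)) =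
    (u + v - 2 * m) * m + (m ^+ 2 - u * v).
  rewrite [X in _ = _ * X + _]mE mulr_sumr -[X in _ = _ + X]mul1r -l1 mulr_suml -big_split.
  by apply: eq_bigr => i _ /=; ring.
have : 0 <= (u + v - 2 * m) ^+ 2 by exact: sqr_ge0.
have : v <= u := hmin _.
nra.
Qed.

Lemma jensen_gap n (l y : 'I_n -> R) (T d m : R) k :
  (forall i, 0 <= l i) -> \sum_i l i = 1 -> m = \sum_i l i * y i ->
  (forall i, 0 <= y i <= T) -> (forall i j, `|y i - y j| <= 2 * d) ->
  `|m ^+ k.+1 - \sum_i l i * y i ^+ k.+1| <=
    (k.+1 * k)%N%:R / 2 * T ^+ (k - 1) * d ^+ 2.
Proof.
move=> l0 l1 mE hy hd.
have hm : 0 <= m <= T.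
  apply/andP; split; rewrite mE.
    by apply: sumr_ge0 => i _; rewrite mulr_ge0 //; case/andP: (hy i).
  rewrite -(mul1r T) -l1 mulr_suml; apply: ler_sum => i _.
  by rewrite ler_wpM2l //; case/andP: (hy i).
have T0 : 0 <= T by case/andP: hm; exact: le_trans.
(* The Taylor remainder at the mean [m]: the first-order terms average to zero. *)
pose r i := y i ^+ k.+1 - m ^+ k.+1 - k.+1%:R * m ^+ k * (y i - m).
have E : \sum_i l i * y i ^+ k.+1 - m ^+ k.+1 = \sum_i l i * r i.
  have -> : \sum_i l i * r i = \sum_i l i * y i ^+ k.+1
     - (\sum_i l i) * m ^+ k.+1 - k.+1%:R * m ^+ k * (\sum_i l i * y i - (\sum_i l i) * m).
    rewrite !mulr_suml -!sumrB mulr_sumr -!sumrB.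
    by apply: eq_bigr => i _; rewrite /r; ring.
  rewrite -mE l1; ring.
rewrite distrC E ger0_norm; last first.
  apply: sumr_ge0 => i _; rewrite mulr_ge0 //.
  by case/andP: (taylor2_pow k (hy i) hm).
have c0 : 0 <= (k.+1 * k)%N%:R / 2 * T ^+ (k - 1).
  by rewrite mulr_ge0 ?divr_ge0 ?exprn_ge0 ?ler0n.
apply: le_trans (ler_wpM2l c0 (variance_le l0 l1 mE hd)).
rewrite mulr_sumr; apply: ler_sum => i _; rewrite mulrCA ler_wpM2l //.
by case/andP: (taylor2_pow k (hy i) hm).
Qed.

End Energy.

(** * Stereographic projection *)

Section Sphere.
Variable R : realType.
Implicit Types (p q a b c : 'rV[R]_2) (S : seq 'rV[R]_2).

Definition north : 'rV[R]_3 := mk3 0 0 1.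
(** The direction from the pole to the point p of the plane z = 0. *)
Definition lft p : 'rV[R]_3 := mk3 (p 0 0) (p 0 1) (- 1).

Lemma dot_mk3 (x y z x' y' z' : R) :
  dot (mk3 x y z) (mk3 x' y' z') = x * x' + y * y' + z * z'.
Proof. by rewrite /dot !big_ord_recl big_ord0 !mxE /= addr0 addrA. Qed.

Lemma dot2E p q : dot p q = p 0 0 * q 0 0 + p 0 1 * q 0 1.
Proof.
rewrite /dot !big_ord_recl big_ord0 addr0.
by congr (_ * _ + p 0 _ * q 0 _); apply: val_inj.
Qed.

Lemma row2P p q : p 0 0 = q 0 0 -> p 0 1 = q 0 1 -> p = q.
Proof.
move=> h0 h1; apply/rowP => i; case: i => -[|[|//]] hi.
  by rewrite (_ : Ordinal hi = 0) //; apply: val_inj.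
by rewrite (_ : Ordinal hi = 1) //; apply: val_inj.
Qed.

Lemma dot_lft p q : dot (lft p) (lft q) = 1 + dot p q.
Proof. by rewrite dot_mk3 dot2E; ring. Qed.

Lemma dot_north_lft p : dot north (lft p) = - 1.
Proof. by rewrite dot_mk3; ring. Qed.

Lemma dot_north : dot north north = 1.
Proof. by rewrite dot_mk3; ring. Qed.

Lemma sigma_inv_ptE p : sigma_inv_pt p = north + (2 / (1 + dot p p)) *: lft p.
Proof.
have h := dot_ge0 p.
apply/rowP => i; rewrite !mxE.
case: i => -[|[|[|]]] //= _; [field|field|field]; by apply/eqP; lra.
Qed.

Lemma dot_sigma p q :
  dot (sigma_inv_pt p) (sigma_inv_pt q) =
  1 - 2 * dot (p - q) (p - q) / ((1 + dot p p) * (1 + dot q q)).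
Proof.
have hp := dot_ge0 p; have hq := dot_ge0 q.
rewrite !sigma_inv_ptE !dotE dot_north dot_lft (dotC (lft p)) !dot_north_lft (dotC q p).
by field; apply/andP; split; apply/eqP; lra.
Qed.

Lemma sigma_unit p : dot (sigma_inv_pt p) (sigma_inv_pt p) = 1.
Proof. by rewrite dot_sigma subrr /dot big1 ?mulr0 ?mul0r ?subr0 // => i _; rewrite mxE mul0r. Qed.

Lemma sqr_dist_sigma p q :
  dot (sigma_inv_pt p - sigma_inv_pt q) (sigma_inv_pt p - sigma_inv_pt q) =
  4 * dot (p - q) (p - q) / ((1 + dot p p) * (1 + dot q q)).
Proof.
rewrite !dotE !sigma_unit (dotC (sigma_inv_pt q)) dot_sigma !dotE.
by ring.
Qed.

Lemma nrm_sigma p : nrm (sigma_inv_pt p) = 1.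
Proof. by rewrite /nrm sigma_unit sqrtr1. Qed.

(* Central projection from the north pole maps conv (sigma_inv_pt S) onto
   conv S; when S lies on the circle |v|^2 = 2 c.v - K the height of the
   preimage of q is explicit. *)
Lemma conv_lift S c (K : R) q : (forall v, v \in S -> dot v v = 2 * dot v c - K) ->
  conv S q ->
  conv (map (@sigma_inv_pt R) S) (north + (2 / (1 + (2 * dot q c - K))) *: lft q).
Proof.
move=> hS [m [m0 [m1 qE]]].
set s := 1 + _.
(* On the circle 1 + |v|^2 is affine in v, so [s] is the mean of its values at the vertices. *)
have sE : s = \sum_(i < size S) m i * (1 + dot (nth 0 S i) (nth 0 S i)).
  transitivity (\sum_(i < size S) m i * (1 - K + 2 * dot (nth 0 S i) c)).
    under eq_bigr do rewrite mulrDr mulrCA -dotZl.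
    by rewrite big_split /= -mulr_suml m1 -mulr_sumr -dot_suml -qE /s; ring.
  by apply: eq_bigr => i _; rewrite (hS _ (mem_nth 0 (ltn_ord i))); ring.
have s1 : 1 <= s.
  rewrite sE -m1; apply: ler_sum => i _; rewrite ler_peMr //.
  by have := dot_ge0 (nth 0 S i); lra.
have sz : size (map (@sigma_inv_pt R) S) = size S by rewrite size_map.
(* These weights cancel the denominators 1 + |v|^2 of the inverse projection and leave multiples of
   [m]. *)
exists (fun i => m (cast_ord sz i) *
    (1 + dot (nth 0 S i) (nth 0 S i)) / s); split.
  move=> i; rewrite divr_ge0 ?mulr_ge0 //; last lra.
  by have := dot_ge0 (nth 0 S i); lra.
have re (V : zmodType) (f : 'I_(size S) -> V) :
    \sum_(i < size (map (@sigma_inv_pt R) S)) f (cast_ord sz i) = \sum_i f i.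
  rewrite (reindex (cast_ord sz)) //=.
  by exists (cast_ord (esym sz)) => i _; rewrite ?cast_ordK ?cast_ordKV.
have sn0 : s != 0 by apply/eqP; lra.
split.
  rewrite (re _ (fun i => m i * (1 + dot (nth 0 S i) (nth 0 S i)) / s)).
  by rewrite -mulr_suml -sE divff.
transitivity (\sum_(i < size S) ((m i * (1 + dot (nth 0 S i) (nth 0 S i)) / s)
    *: sigma_inv_pt (nth 0 S i))); last first.
  rewrite -re; apply: eq_bigr => i _ /=; congr (_ *: _).
  by rewrite (nth_map 0) // -sz.
transitivity (\sum_(i < size S) ((m i * (1 + dot (nth 0 S i) (nth 0 S i)) / s) *: north
    + (2 / s * m i) *: lft (nth 0 S i))); last first.
  apply: eq_bigr => i _; rewrite sigma_inv_ptE scalerDr scalerA; congr (_ + _ *: _).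
  have := dot_ge0 (nth 0 S i) => h; field; apply/andP; split => //; apply/eqP; lra.
rewrite big_split /= -scaler_suml -mulr_suml -sE divff // scale1r.
congr (_ + _).
under eq_bigr do rewrite -scalerA.
rewrite -scaler_sumr; congr (_ *: _).
apply/rowP => j; rewrite summxE qE.
rewrite !mxE; case: j => -[|[|[|]]] //= ?.
- by rewrite summxE; apply: eq_bigr => i _; rewrite !mxE.
- by rewrite summxE; apply: eq_bigr => i _; rewrite !mxE.
- by rewrite -[LHS]mul1r -{1}m1 mulr_suml; apply: eq_bigr => i _; rewrite !mxE.
Qed.

(* With u = d/2 this is sqrt (1 - u^2) >= 1 - u^2/2 - u^4. *)
Lemma chi2_sagitta (d h : R) : 0 <= h -> 1 - d ^+ 2 / 4 <= h ^+ 2 -> 1 - h <= chi 2 d.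
Proof.
move=> h0 hh; rewrite /chi.
have -> : d ^+ 2 / (4 * 2) + d ^+ 4 / (2 * 2 ^+ 3) = (d ^+ 2 / 4) / 2 + (d ^+ 2 / 4) ^+ 2.
  by field.
have w0 : 0 <= d ^+ 2 / 4 by rewrite divr_ge0 ?sqr_ge0.
set w := d ^+ 2 / 4 in hh w0 *.
rewrite lerBlDr -lerBlDl.
have [|e0] := leP (1 - (w / 2 + w ^+ 2)) 0; first by move/le_trans; apply.
rewrite -(@ler_pXn2r _ 2) ?nnegrE // ?(ltW e0) //.
apply: le_trans hh.
nra.
Qed.

Lemma chi_mono (D d e : R) : 0 < D -> 0 <= d <= e -> chi D d <= chi D e.
Proof.
move=> D0 /andP[d0 de]; rewrite /chi.
apply: lerD; rewrite ler_wpM2r ?invr_ge0 ?mulr_ge0 ?exprn_ge0 ?(ltW D0) //;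
  by apply: lerXn2r => //; rewrite nnegrE (le_trans d0).
Qed.

(* The segment from the origin to sigma_inv_pt p meets the plane of the circle
   above S in the point that projects from the pole to ((1 + K)/(1 + K + V)) p. *)
Lemma hull_approx_radial S c (r d : R) p :
  let K := dot c c - r ^+ 2 in let V := r ^+ 2 - dot (p - c) (p - c) in
  (forall v, v \in S -> dot v v = 2 * dot v c - K) -> 0 < 1 + K -> 0 <= V ->
  16 * r ^+ 2 / ((1 + K) ^+ 2 + 4 * r ^+ 2) <= d ^+ 2 ->
  conv S (((1 + K) / (1 + K + V)) *: p) ->
  exists2 X, conv (map (@sigma_inv_pt R) S) X & dist (sigma_inv_pt p) X <= chi 2 d.
Proof.
move=> K V hS E0 V0 hd /(conv_lift hS) hq.
have P0 := dot_ge0 p.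
have VE : V = 2 * dot p c - K - dot p p.
  by rewrite /V /K !dotE (dotC c p); ring.
set E := 1 + K in E0 hd hq *; set P := dot p p in P0 VE.
have J0 : 0 < E * (1 + P) + 2 * V by nra.
have EV : 0 < E + V by lra.
(* The factor that brings the unit vector over p to the plane of the circle; the point moves by 1 -
   h. *)
pose h := E * (1 + P) / (E * (1 + P) + 2 * V).
have h0 : 0 <= h by rewrite divr_ge0 //; nra.
have h1 : h <= 1 by rewrite ler_pdivrMr //; lra.
have s0 : 1 + (2 * dot ((E / (E + V)) *: p) c - K) = (E * (1 + P) + 2 * V) / (E + V).
  rewrite dotZl; have -> : dot p c = (E + V + P - 1) / 2 by rewrite VE /E; field.
  have -> : K = E - 1 by rewrite /E; ring.
  by field; apply/eqP; lra.
have hX : north + (2 / (1 + (2 * dot ((E / (E + V)) *: p) c - K))) *: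
    lft ((E / (E + V)) *: p) = h *: sigma_inv_pt p.
  rewrite s0 /h; apply/rowP => i; rewrite !mxE -/P.
  by case: i => -[|[|[|]]] //= _; field; apply/and3P; split; apply/eqP; lra.
rewrite hX in hq; exists (h *: sigma_inv_pt p) => //.
have -> : dist (sigma_inv_pt p) (h *: sigma_inv_pt p) = 1 - h.
  rewrite /dist -/(nrm _) -[X in nrm (X - _)]scale1r -scalerBl nrmZ nrm_sigma mulr1.
  by rewrite ger0_norm // subr_ge0.
apply: chi2_sagitta => //.
have D0 : 0 < E ^+ 2 + 4 * r ^+ 2 by have := sqr_ge0 r; nra.
(* The squared distance from the origin to the plane of the circle, whose normal is (2c, K - 1). The
   scaled point lies on that plane, so Cauchy-Schwarz against the normal bounds [h] below. *)
apply: (@le_trans _ _ (E ^+ 2 / (E ^+ 2 + 4 * r ^+ 2))).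
  have -> : E ^+ 2 / (E ^+ 2 + 4 * r ^+ 2) =
      1 - (16 * r ^+ 2 / (E ^+ 2 + 4 * r ^+ 2)) / 4 by field; apply/eqP; lra.
  lra.
rewrite expr_div_n ler_pdivrMr // mulrAC ler_pdivlMr ?exprn_gt0 //.
rewrite exprMn -[X in _ <= X]mulrA ler_pM2l ?exprn_gt0 //.
have cs := cauchy_schwarz_sqr (mk3 (2 * p 0 0) (2 * p 0 1) (P - 1))
  (mk3 (2 * c 0 0) (2 * c 0 1) (K - 1)).
rewrite !dot_mk3 in cs.
have PE : P = p 0 0 * p 0 0 + p 0 1 * p 0 1 by rewrite /P dot2E.
have KE : K + r ^+ 2 = c 0 0 * c 0 0 + c 0 1 * c 0 1 by rewrite /K dot2E; ring.
have pcE : dot p c = p 0 0 * c 0 0 + p 0 1 * c 0 1 by rewrite dot2E.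
have -> : E * (1 + P) + 2 * V = 2 * p 0 0 * (2 * c 0 0) + 2 * p 0 1 * (2 * c 0 1)
   + (P - 1) * (K - 1) by rewrite VE pcE /E; ring.
apply: le_trans cs _; rewrite le_eqVlt; apply/orP; left; apply/eqP.
have -> : E ^+ 2 + 4 * r ^+ 2 = (K - 1) ^+ 2 + 4 * (K + r ^+ 2) by rewrite /E; ring.
by rewrite KE PE; ring.
Qed.

End Sphere.

(** * Distance from a point of the sphere to a chord *)

Section Chord.
Variable R : realType.

(* With Z the point of the chord in the hypothesis, X - Z is a nonnegative
   combination of Z and Z - N. The vectors Y with |Y| <= 2 M.Y form a convex cone
   which contains M and the part of M - N orthogonal to the chord, hence also the
   offset Y of X from the chord; then |Y| <= |Y|^2 + 2 M.Y, and the right-hand side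
   is at most |D|^2/4 because |X| = 1. *)
Lemma chord_dist n (A B X N M D m : 'rV[R]_n) (t c1 c2 : R) :
  dot A A = 1 -> dot B B = 1 -> dot X X = 1 ->
  M = 2^-1 *: (A + B) -> D = B - A -> m = M - N ->
  (1 - t) *: A + t *: B = c1 *: N + c2 *: X ->
  0 <= c1 -> 0 < c2 -> c1 + c2 <= 1 -> 0 < dot D D <= 3 ->
  0 <= dot M m ->
  dot m m * dot D D - dot m D ^+ 2 <= 4 * dot M m ^+ 2 * dot D D ->
  exists2 Z, conv [:: A; B] Z & dist X Z <= dot D D / 4.
Proof.
move=> A1 B1 X1 ME DE mE ZE c10 c20 c12 /andP[D0 D3] Mm0 Hm.
have MD : dot M D = 0 by rewrite ME DE !dotE A1 B1 (dotC B A); ring.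
have MM : dot M M = 1 - dot D D / 4.
  by rewrite ME DE !dotE A1 B1 (dotC B A); field.
set dd := dot D D in D0 D3 Hm MM *.
(* The coefficients of X - Z on Z and Z - N. *)
pose k1 := (1 - c1 - c2) / c2; pose k2 := c1 / c2.
have k10 : 0 <= k1 by rewrite divr_ge0 ?(ltW c20) //; lra.
have k20 : 0 <= k2 by rewrite divr_ge0 ?(ltW c20).
have [W WE] : exists W, W = m - (dot m D / dd) *: D by eexists.
have [Y YE] : exists Y, Y = k1 *: M + k2 *: W by eexists.
(* Here Z = M + z D, and [x] collects all the components along D, so that [Y] is orthogonal to D. *)
pose z := t - 2^-1; pose x := z + k1 * z + k2 * (z + dot m D / dd).
have dn0 : dd != 0 by apply/eqP; lra.
have cn0 : c2 != 0 by apply/eqP; lra.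
have XE : X = M + x *: D + Y.
  have {}ZE : X = c2^-1 *: ((1 - t) *: A + t *: B - c1 *: N).
    by rewrite ZE addrC addKr scalerA mulVf // scale1r.
  rewrite ZE YE WE /x /k1 /k2 /z; move: (dot m D / dd) => g; rewrite mE ME DE.
  by apply/rowP => i; rewrite !mxE; field.
have WD : dot W D = 0 by rewrite WE !dotE -/dd; field.
have YD : dot Y D = 0 by rewrite YE !dotE MD WD; ring.
have MW : dot M W = dot M m by rewrite WE !dotE MD; ring.
(* The bound 3 on |D|^2 gives |M|^2 >= 1/4. *)
have nM : 2^-1 * nrm M <= dot M M.
  rewrite -sqr_nrm; have := nrm_ge0 M; have : 2^-1 <= nrm M.
    rewrite -(@ler_pXn2r _ 2) ?nnegrE ?nrm_ge0 ?invr_ge0 // sqr_nrm MM.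
    by rewrite expr2; lra.
  nra.
(* Squared and multiplied by |D|^2, this is the hypothesis [Hm]. *)
have nW : 2^-1 * nrm W <= dot M W.
  rewrite MW -(@ler_pXn2r _ 2) ?nnegrE ?mulr_ge0 ?nrm_ge0 ?invr_ge0 //.
  rewrite exprMn sqr_nrm -(ler_pM2r D0).
  have -> : dot W W = dot m m - dot m D ^+ 2 / dd.
    by rewrite WE !dotE (dotC D m) -/dd; field.
  have -> : 2^-1 ^+ 2 * (dot m m - dot m D ^+ 2 / dd) * dd =
     (dot m m * dd - dot m D ^+ 2) / 4 by field.
  lra.
have nY : 2^-1 * nrm Y <= dot M Y.
  have : nrm Y <= k1 * nrm M + k2 * nrm W.
    by rewrite YE; apply: le_trans (nrmD _ _) _; rewrite !nrmZ !ger0_norm.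
  rewrite YE !dotE.
  have := ler_wpM2l k10 nM; have := ler_wpM2l k20 nW; lra.
have key : nrm Y ^+ 2 + 2 * dot M Y = dd / 4 - x ^+ 2 * dd.
  rewrite sqr_nrm; move: X1; rewrite XE !dotE (dotC D M) (dotC D Y) (dotC Y M).
  by rewrite MD YD MM -/dd; nra.
have Y0 := nrm_ge0 Y.
(* The foot M + x D therefore lies between A and B. *)
have x2 : x ^+ 2 <= 4^-1 by rewrite -(ler_pM2r D0); nra.
exists (M + x *: D); last first.
  rewrite /dist -/(nrm _) XE addrC addKr.
  have : 0 <= x ^+ 2 * dd by rewrite mulr_ge0 ?sqr_ge0 ?ltW.
  nra.
apply/conv_segP; exists (x + 2^-1); first by apply/andP; split; nra.
by rewrite ME DE; apply/rowP => i; rewrite !mxE; field.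
Qed.

End Chord.

(** * Lifting planar edges and disks to the sphere *)

Section Hull.
Variable R : realType.
Implicit Types (p q a b c : 'rV[R]_2) (S : seq 'rV[R]_2).
Local Notation sg := (@sigma_inv_pt R).

Lemma dot_sigma_north p : dot (sigma_inv_pt p) (north R) = 1 - 2 / (1 + dot p p).
Proof. by rewrite sigma_inv_ptE !dotE dot_north (dotC (lft p)) dot_north_lft; ring. Qed.

(** [chord_dist] with N the pole and Z the chord point that projects to [th] p. The two bounds on
    [th] put Z in the triangle of the origin, the pole and the image of p: the lower one gives c1 >=
    0, the upper one c1 + c2 <= 1. The last inequalities are the conditions on the chord, with
    denominators cleared. *)
Lemma hull_approx_edge a b c (r th : R) p :
  let K := dot c c - r ^+ 2 in let V := r ^+ 2 - dot (p - c) (p - c) in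
  let ga := 1 + dot a a in let gb := 1 + dot b b in let P := 1 + dot a b in
  let w := dot (a - b) (a - b) in
  (forall v, v \in [:: a; b] -> dot v v = 2 * dot v c - K) -> 0 < 1 + K -> 0 <= V ->
  1 + K <= th * (1 + K + V) -> th <= 1 ->
  conv [:: a; b] (th *: p) ->
  0 <= P -> 0 < w -> 4 * w <= 3 * (ga * gb) ->
  (ga * gb - P ^+ 2) * (ga * gb) <= 4 * P ^+ 2 * w ->
  exists2 X, conv [:: sg a; sg b] X & dist (sg p) X <= dist (sg a) (sg b) ^+ 2 / 4.
Proof.
move=> K V ga gb P w hS E0 V0 hth th1 /(conv_lift hS) /conv_segP [t t01 tE] P0 w0 w3 Hw.
have PP0 := dot_ge0 p.
have VE : V = 2 * dot p c - K - dot p p.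
  by rewrite /V /K !dotE (dotC c p); ring.
set s := 1 + (2 * dot (th *: p) c - K) in tE.
have th0 : 0 < th.
  by have := lt_le_trans E0 hth; rewrite pmulr_lgt0 //; lra.
have sE : s = 1 + th * (V + dot p p + K) - K by rewrite /s dotZl VE; ring.
have s1 : 1 <= s.
  have : 0 <= th * dot p p by rewrite mulr_ge0 // ltW.
  rewrite sE; nra.
pose c2 := th * (1 + dot p p) / s; pose c1 := (s - 2 + 2 * th - th * (1 + dot p p)) / s.
have sn0 : s != 0 by apply/eqP; lra.
have gp0 : 1 + dot p p != 0 by apply/eqP; lra.
have a0 := dot_ge0 a; have b0 := dot_ge0 b.
have ga0 : 0 < ga by rewrite /ga; lra.
have gb0 : 0 < gb by rewrite /gb; lra.
have gan0 : ga != 0 by apply/eqP; lra.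
have gbn0 : gb != 0 by apply/eqP; lra.
have gg0 : 0 < ga * gb by rewrite mulr_gt0.
have wE : w = ga + gb - 2 * P by rewrite /w /ga /gb /P !dotE (dotC b a); ring.
have aN := dot_sigma_north a; have bN := dot_sigma_north b.
have ab : dot (sg a) (sg b) = 1 - 2 * w / (ga * gb) by exact: dot_sigma.
have aa := sigma_unit a; have bb := sigma_unit b.
rewrite -/ga in aN; rewrite -/gb in bN.
have DD : dot (sg b - sg a) (sg b - sg a) = 4 * w / (ga * gb).
  by rewrite !dotE aa bb (dotC (sg b) (sg a)) ab; field; rewrite gan0 gbn0.
have -> : dist (sg a) (sg b) ^+ 2 = dot (sg b - sg a) (sg b - sg a).
  by rewrite /dist -/(nrm _) -nrmN opprB sqr_nrm.
have Mm : dot (2^-1 *: (sg a + sg b)) (2^-1 *: (sg a + sg b) - north R) = 2 * P / (ga * gb).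
  rewrite !dotE aa bb (dotC (sg b) (sg a)) ab aN bN wE.
  by field; rewrite gan0 gbn0.
apply: (@chord_dist R 3 (sg a) (sg b) (sg p) (north R) _ _ _ t c1 c2) => //.
- exact: sigma_unit.
- rewrite -tE sigma_inv_ptE /c1 /c2; apply/rowP => i; rewrite !mxE.
  by case: i => -[|[|[|]]] //= _; field; rewrite ?sn0 ?gp0.
- by rewrite divr_ge0 //; [rewrite sE; nra|lra].
- by rewrite divr_gt0 ?mulr_gt0 //; lra.
- by rewrite -mulrDl ler_pdivrMr; lra.
- by rewrite DD divr_gt0 ?mulr_gt0 //= ler_pdivrMr.
- by rewrite Mm divr_ge0 ?mulr_ge0 ?(ltW ga0) ?(ltW gb0).
rewrite Mm DD.
have -> : dot (2^-1 *: (sg a + sg b) - north R) (2^-1 *: (sg a + sg b) - north R) =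
    2 / ga + 2 / gb - w / (ga * gb).
  rewrite !dotE aa bb dot_north (dotC (sg b) (sg a)) !(dotC (north R)) ab aN bN.
  by field; rewrite gan0 gbn0.
have -> : dot (2^-1 *: (sg a + sg b) - north R) (sg b - sg a) = 2 / gb - 2 / ga.
  rewrite !dotE aa bb (dotC (sg b) (sg a)) !(dotC (north R)) ab aN bN.
  by field; rewrite gan0 gbn0.
rewrite -subr_ge0.
have -> : 4 * (2 * P / (ga * gb)) ^+ 2 * (4 * w / (ga * gb)) -
  ((2 / ga + 2 / gb - w / (ga * gb)) * (4 * w / (ga * gb)) - (2 / gb - 2 / ga) ^+ 2) =
  16 * (4 * P ^+ 2 * w - (ga * gb - P ^+ 2) * (ga * gb)) / (ga * gb) ^+ 3.
  by rewrite wE; field; rewrite gan0 gbn0.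
by rewrite divr_ge0 ?exprn_ge0 ?(ltW gg0) // mulr_ge0 // subr_ge0.
Qed.

(** The line q.l = k lifts to the plane through the pole with normal (l, k). The lifted functional
    minus k is a positive multiple of q.l - k, so strict sides are preserved. *)
Lemma side_is_edge S a b (l : 'rV[R]_2) (k : R) :
  a \in S -> b \in S -> 0 < dot (a - b) (a - b) -> dot a l = k -> dot b l = k ->
  (forall q, q \in S -> q != a -> q != b -> dot q l < k) ->
  is_edge (map sg S) (sg a) (sg b).
Proof.
move=> aS bS ab al bl H.
have E q : dot (sg q) (mk3 (l 0 0) (l 0 1) k) = k + 2 / (1 + dot q q) * (dot q l - k).
  rewrite sigma_inv_ptE !dotE !dot_mk3 dot2E.
  by rewrite (dot2E q l); ring.
have g0 q : 0 < 1 + dot q q by have := dot_ge0 q; lra.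
apply: (@is_edge_support R 3 _ _ _ (mk3 (l 0 0) (l 0 1) k) k).
- exact: map_f.
- exact: map_f.
- apply/eqP => e; have := sqr_dist_sigma a b.
  rewrite e subrr -[X in dot X X](scale0r (sg b)) dotZl mul0r => /eqP.
  by rewrite eq_sym gt_eqF // divr_gt0 // mulr_gt0.
- by rewrite E al subrr mulr0 addr0.
- by rewrite E bl subrr mulr0 addr0.
move=> _ /mapP[q qS ->] qa qb; rewrite E gtrDl pmulr_rlt0 ?divr_gt0 // subr_lt0.
by apply: H => //; [apply: contraNneq qa|apply: contraNneq qb] => ->.
Qed.

(** The disk has a diameter on the line through the origin and its centre. The images of its two
    ends are at a distance equal to the diameter of the image circle. *)
Lemma d2_cap (Q : piece R) : let c := (DQ Q).1 in let r := (DQ Q).2 in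
  let K := dot c c - r ^+ 2 in 0 <= r -> 
  0 <= d2 Q /\ 16 * r ^+ 2 / ((1 + K) ^+ 2 + 4 * r ^+ 2) <= d2 Q ^+ 2.
Proof.
move=> c r K r0.
(* A unit vector along [c]; if [c] is zero, (1, 0) serves. *)
have [e e1 ce] : exists2 e : 'rV[R]_2, dot e e = 1 & dot c e ^+ 2 = dot c c.
  have [c0|c0] := eqVneq (dot c c) 0.
    exists (mk2 1 0); first by rewrite dot2E !mxE /=; ring.
    apply/eqP; rewrite c0 sqrf_eq0; apply/eqP.
    have := cauchy_schwarz_sqr c (mk2 1 0); rewrite c0 mul0r => h.
    by apply/eqP; rewrite -sqrf_eq0; apply/eqP/le_anti; rewrite h sqr_ge0.
  have n0 : nrm c != 0 by rewrite -sqrf_eq0 sqr_nrm.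
  exists ((nrm c)^-1 *: c); rewrite !dotE -!sqr_nrm; field; exact: n0.
have D u (t : R) : t ^+ 2 = r ^+ 2 -> u = c + t *: e -> closed_disk (DQ Q) u.
  move=> t2 ->; rewrite /closed_disk /= /dist addrAC subrr add0r -/(nrm _).
  by apply: nrm_le => //; rewrite !dotE e1 -t2; lra.
have h : dist (sg (c + r *: e)) (sg (c + (- r) *: e)) <= d2 Q.
  apply: (@dist_le_diam _ _ _ 1).
  - by move=> _ [u _ <-]; rewrite nrm_sigma.
  - by exists (c + r *: e) => //; exact: (@D _ r).
  - by exists (c + - r *: e) => //; apply: (@D _ (- r)); rewrite ?sqrrN.
have d0 : 0 <= d2 Q := le_trans (nrm_ge0 _) h.
split=> //; apply: le_trans (_ : dist (sg (c + r *: e)) (sg (c + (- r) *: e)) ^+ 2 <= _); last first.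
  by rewrite ler_pXn2r // nnegrE; exact: nrm_ge0.
rewrite [dist _ _]/(nrm _) sqr_nrm sqr_dist_sigma.
have c0 := dot_ge0 c.
have -> : dot (c + r *: e - (c + - r *: e)) (c + r *: e - (c + - r *: e)) = 4 * r ^+ 2.
  by rewrite !dotE e1; ring.
have -> : (1 + dot (c + r *: e) (c + r *: e)) * (1 + dot (c + - r *: e) (c + - r *: e))
  = (1 + K) ^+ 2 + 4 * r ^+ 2.
  have -> : (1 + K) ^+ 2 + 4 * r ^+ 2 = (1 + dot c c + r ^+ 2) ^+ 2 - 4 * r ^+ 2 * dot c c.
    by rewrite /K; ring.
  by rewrite -{2}ce !dotE e1 (dotC e c); ring.
by rewrite mulrA -natrM.
Qed.

End Hull.

(** * Segments and squares *)

Section Pieces.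
Variable R : realType.
Implicit Types (p q : 'rV[R]_2) (Q : piece R).
Local Notation sg := (@sigma_inv_pt R).

(** What dyadic segments and good squares contribute to the geometry. [Inf] is excluded because only
    finite points are moved to vertices. *)
Definition regular_piece Q : Prop :=
  match Q with
  | Seg a b => 0 <= a < b
  | Sq x y s => [/\ 0 < s <= 1 / 2, - (3 / 2) <= x, x + s <= 3 / 2,
                    - (3 / 2) <= y & y + s <= 3 / 2]
  | Inf => False
  end.

Lemma dyadic_segment_bounds (a b : R) : dyadic_segment a b -> 0 <= a < b.
Proof.
elim=> {a b} [|a b _ /andP[h1 h2]|a b _ /andP[h1 h2]]; apply/andP; split; lra.
Qed.

Lemma dyadic_square_pos (x y s : R) : dyadic_square x y s -> 0 < s.
Proof. by elim=> // {}x {}y {}s i j _ h; lra. Qed.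

Lemma good_square_regular (x y s : R) : good_square x y s -> regular_piece (Sq x y s).
Proof. by move=> [/dyadic_square_pos s0 [h1 [h2 [h3 [h4 h5]]]]]; split; rewrite ?s0. Qed.

Lemma mk2_0 (x y : R) : (mk2 x y) 0 0 = x. Proof. by rewrite mxE. Qed.
Lemma mk2_1 (x y : R) : (mk2 x y) 0 1 = y. Proof. by rewrite mxE. Qed.
Definition mk2E := (mk2_0, mk2_1).

Lemma sqr_dist2 p q : dist p q ^+ 2 = (p 0 0 - q 0 0) ^+ 2 + (p 0 1 - q 0 1) ^+ 2.
Proof. by rewrite [dist _ _]/(nrm _) sqr_nrm dot2E !mxE; ring. Qed.

Lemma dist_eqP p q (r : R) : 0 <= r -> dist p q ^+ 2 = r ^+ 2 -> dist p q = r.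
Proof.
by move=> r0 /eqP; rewrite eqrXn2 ?nrm_ge0 // => /eqP.
Qed.

(** Subtracting the circle equations at adjacent corners leaves linear equations for the centre. *)
Lemma disk_through_sq (x y s : R) cr : 0 < s -> disk_through (Sq x y s) cr ->
  cr.1 = mk2 (x + s / 2) (y + s / 2) /\ cr.2 ^+ 2 = s ^+ 2 / 2.
Proof.
move=> s0 [r0 h].
have H a b : mk2 a b \in verts (Sq x y s) ->
    (a - cr.1 0 0) ^+ 2 + (b - cr.1 0 1) ^+ 2 = cr.2 ^+ 2.
  by move/h => /(congr1 (fun z => z ^+ 2)); rewrite sqr_dist2 !mk2E.
have /H h0 : mk2 x y \in verts (Sq x y s) by rewrite !inE eqxx.
have /H h1 : mk2 (x + s) y \in verts (Sq x y s) by rewrite !inE eqxx orbT.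
have /H h2 : mk2 x (y + s) \in verts (Sq x y s) by rewrite !inE eqxx !orbT.
have e0 : cr.1 0 0 = x + s / 2.
  apply: (mulfI (_ : s != 0)); first by rewrite gt_eqF.
  lra.
have e1 : cr.1 0 1 = y + s / 2.
  apply: (mulfI (_ : s != 0)); first by rewrite gt_eqF.
  lra.
split; first by apply: row2P; rewrite mk2E.
by rewrite -h0 e0 e1; field.
Qed.

(** [DQ] is a choice, so its specification becomes available once a smallest disk is exhibited. *)
Lemma DQ_sq (x y s : R) : 0 < s ->
  disk_through (Sq x y s) (DQ (Sq x y s)).
Proof.
move=> s0.
have s20 : 0 <= s ^+ 2 / 2 by rewrite divr_ge0 ?sqr_ge0.
suff : smallest_disk (Sq x y s) (DQ (Sq x y s)) by case.
apply: xgetPex; exists (mk2 (x + s / 2) (y + s / 2), Num.sqrt (s ^+ 2 / 2)); split.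
  split => [|q]; first exact: sqrtr_ge0.
  move=> hq; apply: dist_eqP; first exact: sqrtr_ge0.
  rewrite sqr_dist2 /= sqr_sqrtr //.
  by move: hq; rewrite !inE => /or4P[] /eqP ->; rewrite !mk2E; field.
move=> cr' h; have [_ h2] := disk_through_sq s0 h.
by rewrite -(@ler_pXn2r _ 2) ?nnegrE ?sqrtr_ge0 //=; [rewrite sqr_sqrtr // h2|case: h].
Qed.

(** The centres lie on the perpendicular bisector, with r^2 = ((b - a)/2)^2 + height^2; minimality
    forces height 0. *)
Lemma DQ_seg (a b : R) : a < b ->
  disk_through (Seg a b) (DQ (Seg a b)) /\
  (DQ (Seg a b)).1 = mk2 ((a + b) / 2) 0 /\ (DQ (Seg a b)).2 ^+ 2 = ((b - a) / 2) ^+ 2.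
Proof.
move=> ab.
have E cr : disk_through (Seg a b) cr ->
    cr.1 0 0 = (a + b) / 2 /\ cr.2 ^+ 2 = ((b - a) / 2) ^+ 2 + (cr.1 0 1) ^+ 2.
  move=> [r0 h].
  have /h ha : mk2 a 0 \in verts (Seg a b) by rewrite !inE eqxx.
  have /h hb : mk2 b 0 \in verts (Seg a b) by rewrite !inE eqxx orbT.
  move: ha hb => /(congr1 (fun z => z ^+ 2)) + /(congr1 (fun z => z ^+ 2)).
  rewrite !sqr_dist2 !mk2E => ha hb.
  have e0 : cr.1 0 0 = (a + b) / 2.
    apply: (mulfI (_ : b - a != 0)); first by rewrite gt_eqF // subr_gt0.
    lra.
  by split=> //; rewrite -ha e0; field.
have r0 : 0 <= (b - a) / 2 by lra.
have D0 : disk_through (Seg a b) (mk2 ((a + b) / 2) 0, (b - a) / 2).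
  split => [//|q hq]; apply: dist_eqP => //; rewrite sqr_dist2 /=.
  by move: hq; rewrite !inE => /orP[] /eqP ->; rewrite !mk2E; field.
have [h hmin] : smallest_disk (Seg a b) (DQ (Seg a b)).
  apply: xgetPex; exists (mk2 ((a + b) / 2) 0, (b - a) / 2); split => // cr' h.
  have [_ h2] := E _ h; rewrite -(@ler_pXn2r _ 2) ?nnegrE //=; last by case: h.
  by rewrite h2 lerDl sqr_ge0.
have [e0 e2] := E _ h.
have := hmin _ D0; rewrite -(@ler_pXn2r _ 2) ?nnegrE //=; last by case: h.
rewrite e2 gerDl => z.
have z0 : (DQ (Seg a b)).1 0 1 = 0.
  by apply/eqP; rewrite -sqrf_eq0; apply/eqP/le_anti; rewrite z sqr_ge0.
split=> //; split; last by rewrite z0; ring.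
by apply: row2P; rewrite mk2E.
Qed.

Lemma on_circle Q v : disk_through Q (DQ Q) -> v \in verts Q ->
  dot v v = 2 * dot v (DQ Q).1 - (dot (DQ Q).1 (DQ Q).1 - (DQ Q).2 ^+ 2).
Proof.
move=> [_ h] /h <-; rewrite [dist _ _]/(nrm _) sqr_nrm !dotE (dotC _ v); ring.
Qed.

(** |p|^2 is at most the mean of |v|^2 over the vertices, and on the circle |v|^2 is affine in v. *)
Lemma in_disk Q p : disk_through Q (DQ Q) -> conv (verts Q) p ->
  0 <= (DQ Q).2 ^+ 2 - dot (p - (DQ Q).1) (p - (DQ Q).1).
Proof.
move=> h [l [l0 [l1 pE]]]; set c := (DQ Q).1; set r := (DQ Q).2.
have := sqnorm_mean_le l0 l1 pE.
have -> : \sum_(i < size (verts Q)) l i * dot (nth 0 (verts Q) i) (nth 0 (verts Q) i) =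
    \sum_(i < size (verts Q)) (dot (l i *: nth 0 (verts Q) i) (2 *: c)
      - l i * (dot c c - r ^+ 2)).
  apply: eq_bigr => i _; rewrite (on_circle h (mem_nth 0 (ltn_ord i))) -/c -/r !dotE.
  by ring.
by rewrite sumrB -dot_suml -pE -mulr_suml l1 !dotE (dotC c p); lra.
Qed.

(** On the nonnegative axis the radial projection always stays in the hull: the scaled point g u is
    at most b because g <= 1, and at least a because (1 + ab)u - a(1 + ab + (u - a)(b - u)) = (u -
    a)(1 + au). *)
Lemma hull_approx_seg (a b : R) p : 0 <= a < b -> conv (verts (Seg a b)) p ->
  exists2 X, conv (map sg (verts (Seg a b))) X & dist (sg p) X <= delta (Seg a b).
Proof.
move=> /andP[a0 ab] hp; set Q := Seg a b in hp *.
have [hD [hc hr]] := DQ_seg ab; have r0 := hD.1.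
have V0 := in_disk hD hp; have [d0 dcap] := d2_cap r0.
have /conv_segP[t t01 pE] := hp.
apply: (@hull_approx_radial R (verts Q) (DQ Q).1 (DQ Q).2 (d2 Q) p) => //.
- by move=> v; exact: on_circle.
- rewrite hc hr dot2E !mk2E; nra.
have tE : p = mk2 (a + t * (b - a)) 0.
  by rewrite pE; apply: row2P; rewrite !mxE /=; ring.
move: V0; rewrite hc hr tE => V0.
set u := a + t * (b - a) in V0 *.
have [ua ub] : a <= u /\ u <= b by move: t01 => /andP[??]; split; rewrite /u; nra.
have KE : dot (mk2 ((a + b) / 2) 0) (mk2 ((a + b) / 2) 0) - ((b - a) / 2) ^+ 2 = a * b.
  by rewrite dot2E !mk2E; field.
have VE : ((b - a) / 2) ^+ 2 - dot (mk2 u 0 - mk2 ((a + b) / 2) 0)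
   (mk2 u 0 - mk2 ((a + b) / 2) 0) = (u - a) * (b - u).
  by rewrite dot2E !mxE /=; field.
rewrite KE VE.
have ab0 : 0 <= a * b by rewrite mulr_ge0 //; lra.
have v0 : 0 <= (u - a) * (b - u) by rewrite mulr_ge0 ?subr_ge0.
set g := (1 + a * b) / _.
have D0 : 0 < 1 + a * b + (u - a) * (b - u) by lra.
have gu : a <= g * u <= b.
  apply/andP; split.
    rewrite /g mulrAC ler_pdivlMr // -subr_ge0.
    have -> : (1 + a * b) * u - a * (1 + a * b + (u - a) * (b - u)) =
       (u - a) * (1 + a * u) by ring.
    by rewrite mulr_ge0 ?subr_ge0 // addr_ge0 ?mulr_ge0 //; lra.
  have : g <= 1 by rewrite ler_pdivrMr //; lra.
  have : 0 <= g by rewrite divr_ge0 //; lra.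
  nra.
apply/conv_segP; exists ((g * u - a) / (b - a)).
  move/andP: gu => [g1 g2]; rewrite divr_ge0 ?subr_ge0 ?(ltW ab) //=.
  by rewrite ler_pdivrMr ?subr_gt0 // mul1r lerD2r.
by apply: row2P; rewrite !mxE /=; field; rewrite gt_eqF // subr_gt0.
Qed.

Lemma sq_conv_box (x y s : R) p : 0 < s ->
  conv (verts (Sq x y s)) p <->
  [/\ x <= p 0 0, p 0 0 <= x + s, y <= p 0 1 & p 0 1 <= y + s].
Proof.
move=> s0; split=> [hp|[h1 h2 h3 h4]].
  have H (u v k : R) : (forall q, q \in verts (Sq x y s) -> dot q (mk2 u v) <= k) ->
      p 0 0 * u + p 0 1 * v <= k.
    by move=> h; have := conv_dot_le h hp; rewrite dot2E !mk2E.
  have B q : q \in verts (Sq x y s) ->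
      [/\ x <= q 0 0, q 0 0 <= x + s, y <= q 0 1 & q 0 1 <= y + s].
    by rewrite !inE => /or4P[] /eqP ->; rewrite !mk2E; split; lra.
  have h1 : p 0 0 * - 1 + p 0 1 * 0 <= - x by apply: H => q /B[]; rewrite dot2E !mk2E; lra.
  have h2 : p 0 0 * 1 + p 0 1 * 0 <= x + s by apply: H => q /B[]; rewrite dot2E !mk2E; lra.
  have h3 : p 0 0 * 0 + p 0 1 * - 1 <= - y by apply: H => q /B[]; rewrite dot2E !mk2E; lra.
  have h4 : p 0 0 * 0 + p 0 1 * 1 <= y + s by apply: H => q /B[]; rewrite dot2E !mk2E; lra.
  split; lra.
pose t := (p 0 0 - x) / s; pose u := (p 0 1 - y) / s.
have t01 : 0 <= t <= 1.
  by rewrite divr_ge0 ?ler_pdivrMr ?(ltW s0) //=; lra.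
have u01 : 0 <= u <= 1.
  by rewrite divr_ge0 ?ler_pdivrMr ?(ltW s0) //=; lra.
have -> : p = (1 - u) *: ((1 - t) *: mk2 x y + t *: mk2 (x + s) y) +
   u *: ((1 - t) *: mk2 x (y + s) + t *: mk2 (x + s) (y + s)).
  by apply: row2P; rewrite !mxE /= /t /u; field; rewrite gt_eqF.
do 3?apply: conv_comb => //; apply: conv_mem; by rewrite !inE eqxx ?orbT.
Qed.

(** As the factor decreases from 1 to [g], [th] is where the scaled [u] leaves the interval, or [g]
    if it never does. It leaves through l only if u > 0 and through l + s only if u < 0. *)
Lemma shrink_interval (l s g u : R) : 0 <= g <= 1 -> l <= u <= l + s ->
  exists th, [/\ g <= th <= 1, forall t, th <= t <= 1 -> l <= t * u <= l + s &
    [\/ th = g, th * u = l | th * u = l + s]].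
Proof.
move=> /andP[g0 g1] /andP[lu us].
have [h1|h1] := leP l (g * u); last first.
  have u0 : 0 < u by nra.
  exists (l / u); split.
  - by rewrite ler_pdivlMr // ler_pdivrMr // (ltW h1) mul1r.
  - by move=> t; rewrite ler_pdivrMr // => /andP[-> t1]; nra.
  - by apply: Or32; rewrite divfK // gt_eqF.
have [h2|h2] := leP (g * u) (l + s).
  exists g; split; [by rewrite lexx| |exact: Or31].
  by move=> t /andP[gt t1]; have [u0|u0] := leP 0 u; apply/andP; split; nra.
have u0 : u < 0 by nra.
exists ((l + s) / u); split.
- by rewrite ler_ndivlMr // ler_ndivrMr // (ltW h2) mul1r.
- by move=> t; rewrite ler_ndivrMr // => /andP[tt t1]; apply/andP; split; nra.
- by apply: Or33; rewrite divfK // lt_eqF.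
Qed.

(* The circle through the pole over a line at distance at most 3/2 from the
   origin has diameter at least 2/sqrt(13/4) > 1. *)
Lemma side_cone (h y z : R) : 1 <= h <= 13 / 4 -> (y - z) ^+ 2 <= 1 / 4 ->
  [/\ 0 <= h + y * z,
   4 * (y - z) ^+ 2 <= 3 * ((h + y ^+ 2) * (h + z ^+ 2)) &
   ((h + y ^+ 2) * (h + z ^+ 2) - (h + y * z) ^+ 2) * ((h + y ^+ 2) * (h + z ^+ 2))
     <= 4 * (h + y * z) ^+ 2 * (y - z) ^+ 2].
Proof.
move=> /andP[h1 h2] hw.
(* 4yz = (y + z)^2 - (y - z)^2 >= -1/4. *)
have yz : - (1 / 16) <= y * z.
  have : 0 <= (y + z) ^+ 2 by exact: sqr_ge0.
  nra.
have P1 : 15 / 16 * h <= h + y * z by lra.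
have -> : (h + y ^+ 2) * (h + z ^+ 2) = (h + y * z) ^+ 2 + h * (y - z) ^+ 2 by ring.
have w0 : 0 <= (y - z) ^+ 2 by exact: sqr_ge0.
move: ((y - z) ^+ 2) (h + y * z) w0 hw P1 => w P w0 hw P1.
have P2 : 225 / 256 * h ^+ 2 <= P ^+ 2.
  have -> : 225 / 256 * h ^+ 2 = (15 / 16 * h) ^+ 2 by field.
  apply: lerXn2r => //; rewrite nnegrE; lra.
have hh : 1 <= h ^+ 2 by rewrite expr2; nra.
split; first lra.
  by have : 0 <= h * w by [rewrite mulr_ge0 //; lra]; nra.
have -> : (P ^+ 2 + h * w - P ^+ 2) * (P ^+ 2 + h * w) = (h * P ^+ 2 + h ^+ 2 * w) * w.
  by ring.
rewrite ler_wpM2r //.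
(* By [P2] the two terms are at most 64/225 P^2 and 13/4 P^2, together below 4 P^2. *)
have : h ^+ 2 * w <= h ^+ 2 * (1 / 4) by rewrite ler_wpM2l // sqr_ge0.
have : h * P ^+ 2 <= 13 / 4 * P ^+ 2 by rewrite ler_wpM2r // sqr_ge0.
lra.
Qed.

End Pieces.

(** * Hull approximation for squares *)

Section Squares.
Variable R : realType.
Implicit Types (p q a b l : 'rV[R]_2) (Q : piece R).
Local Notation sg := (@sigma_inv_pt R).

Lemma chi1_ge (d e : R) : 0 <= d <= e -> d ^+ 2 / 4 <= chi 1 e.
Proof.
move=> de; apply: le_trans (chi_mono ltr01 de).
by rewrite /chi expr1n !mulr1 lerDl divr_ge0 ?exprn_ge0 //; case/andP: de.
Qed.

(** Since r^2 = s^2/2 <= 1/8, the origin lies strictly on the side of the circle's plane away from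
    the cap. *)
Lemma sq_curvature (x y s : R) : regular_piece (Sq x y s) ->
  0 < 1 + (dot (DQ (Sq x y s)).1 (DQ (Sq x y s)).1 - (DQ (Sq x y s)).2 ^+ 2).
Proof.
move=> [/andP[s0 s1] _ _ _ _]; have [_ ->] := disk_through_sq s0 (DQ_sq x y s0).
have := dot_ge0 (DQ (Sq x y s)).1; nra.
Qed.

(** One statement for all four sides: [u] and [v] are the varying coordinates of the ends, [h] is 1
    plus the square of the constant one, and [l], [k] describe the supporting line. *)
Lemma hull_approx_side (x y s h u v k th : R) a b l p :
  let Q := Sq x y s in
  let K := dot (DQ Q).1 (DQ Q).1 - (DQ Q).2 ^+ 2 in
  let V := (DQ Q).2 ^+ 2 - dot (p - (DQ Q).1) (p - (DQ Q).1) in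
  regular_piece Q -> conv (verts Q) p ->
  a \in verts Q -> b \in verts Q ->
  1 <= h <= 13 / 4 -> (u - v) ^+ 2 = s ^+ 2 ->
  1 + dot a a = h + u ^+ 2 -> 1 + dot b b = h + v ^+ 2 -> 1 + dot a b = h + u * v ->
  dot a l = k -> dot b l = k ->
  (forall q, q \in verts Q -> q != a -> q != b -> dot q l < k) ->
  1 + K <= th * (1 + K + V) -> th <= 1 -> conv [:: a; b] (th *: p) ->
  exists2 X, conv (map sg (verts Q)) X & dist (sg p) X <= delta Q.
Proof.
move=> Q K V hQ hp aQ bQ hh uvs aa bb ab al bl hl hth th1 hc.
have [/andP[s0 s1] _ _ _ _] := hQ.
have hD := DQ_sq x y s0.
have uv : (u - v) ^+ 2 <= 1 / 4 by rewrite uvs; nra.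
have w : dot (a - b) (a - b) = (u - v) ^+ 2.
  by rewrite !dotE (dotC b a); nra.
have w0 : 0 < dot (a - b) (a - b) by rewrite w uvs exprn_gt0.
have [P0 w3 Hw] := side_cone hh uv.
have [X hX dX] : exists2 X, conv [:: sg a; sg b] X &
    dist (sg p) X <= dist (sg a) (sg b) ^+ 2 / 4.
  apply: (@hull_approx_edge R a b (DQ Q).1 (DQ Q).2 th p) => //.
  - by move=> q; rewrite !inE => /orP[]/eqP ->; exact: on_circle.
  - exact: sq_curvature.
  - exact: in_disk.
  - by rewrite ab.
  - by rewrite w aa bb.
  - by rewrite w aa bb ab.
exists X; first by apply: conv_seg_sub hX; exact: map_f.
apply: le_trans dX _; rewrite /delta le_max chi1_ge // /d1.
rewrite [X in X && _]sqrtr_ge0 /=; apply: edge_le_longest; last exact: side_is_edge hl.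
by move=> _ /mapP[[q|] _ ->]; rewrite ?nrm_sigma // /nrm dot_north sqrtr1.
Qed.

(** Scale p towards the origin by factors from 1 down to [g]. If it stays in the square, the radial
    projection lies in the hull; otherwise the side through which it leaves is the edge to use. *)
Lemma hull_approx_sq (x y s : R) p : regular_piece (Sq x y s) ->
  conv (verts (Sq x y s)) p ->
  exists2 X, conv (map sg (verts (Sq x y s))) X & dist (sg p) X <= delta (Sq x y s).
Proof.
move=> hQ hp; set Q := Sq x y s in hQ hp *.
have [/andP[s0 s1] x0 x1 y0 y1] := hQ.
have hD := DQ_sq x y s0; rewrite -/Q in hD.
have E0 := sq_curvature hQ; rewrite -/Q in E0.
have V0 := in_disk hD hp; have [d0 dcap] := d2_cap hD.1.
have [p1 p2 p3 p4] := (sq_conv_box x y p s0).1 hp.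
set c := (DQ Q).1 in E0 V0 dcap *; set r := (DQ Q).2 in E0 V0 dcap *.
set K := dot c c - r ^+ 2 in E0 dcap *.
set V := r ^+ 2 - dot (p - c) (p - c) in V0 *.
pose g := (1 + K) / (1 + K + V).
have EV : 0 < 1 + K + V by lra.
have g01 : 0 <= g <= 1 by rewrite divr_ge0 ?ler_pdivrMr //=; lra.
have gth th : g <= th -> 1 + K <= th * (1 + K + V) by rewrite ler_pdivrMr.
have [t [/andP[gt t1] ht tE]] : exists t, [/\ g <= t <= 1,
    forall z, t <= z <= 1 -> x <= z * p 0 0 <= x + s &
    [\/ t = g, t * p 0 0 = x | t * p 0 0 = x + s]].
  by apply: shrink_interval => //; rewrite p1.
have [u [/andP[gu u1] hu uE]] : exists t, [/\ g <= t <= 1,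
    forall z, t <= z <= 1 -> y <= z * p 0 1 <= y + s &
    [\/ t = g, t * p 0 1 = y | t * p 0 1 = y + s]].
  by apply: shrink_interval => //; rewrite p3.
have inseg a b q (i : R) : 0 <= i <= s -> q = (1 - i / s) *: a + (i / s) *: b ->
    conv [:: a; b] q.
  move=> /andP[i0 i1] ->; apply/conv_segP; exists (i / s) => //.
  by rewrite divr_ge0 ?ler_pdivrMr ?(ltW s0) //= mul1r.
have sn0 : s != 0 by rewrite gt_eqF.
have vert th z : th <= 1 -> g <= th -> th * p 0 0 = z -> y <= th * p 0 1 <= y + s ->
    (z = x \/ z = x + s) ->
    exists2 X, conv (map sg (verts Q)) X & dist (sg p) X <= delta Q.
  move=> th1 gth1 hz /andP[hy1 hy2] zE.
  have zb : 1 <= 1 + z ^+ 2 <= 13 / 4.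
    have := sqr_ge0 z; case: zE => -> ?; apply/andP; split; nra.
  have hseg : conv [:: mk2 z y; mk2 z (y + s)] (th *: p).
    apply: (inseg _ _ _ (th * p 0 1 - y)); first by apply/andP; split; lra.
    by apply: row2P; rewrite !mxE /= ?hz; field.
  case: zE => zx.
    apply: (@hull_approx_side x y s (1 + z ^+ 2) y (y + s) (- z) th _ _ (mk2 (- 1) 0) p
      hQ hp _ _ zb _ _ _ _ _ _ _ (gth _ gth1) th1 hseg);
      rewrite ?dot2E ?mk2E; try (by ring); rewrite ?zx ?inE ?eqxx ?orbT //.
    by move=> q; rewrite !inE => /or4P[] /eqP ->; rewrite ?eqxx // dot2E !mk2E; lra.
  apply: (@hull_approx_side x y s (1 + z ^+ 2) y (y + s) z th _ _ (mk2 1 0) p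
      hQ hp _ _ zb _ _ _ _ _ _ _ (gth _ gth1) th1 hseg);
      rewrite ?dot2E ?mk2E; try (by ring); rewrite ?zx ?inE ?eqxx ?orbT //.
  by move=> q; rewrite !inE => /or4P[] /eqP ->; rewrite ?eqxx // dot2E !mk2E; lra.
have horz th z : th <= 1 -> g <= th -> th * p 0 1 = z -> x <= th * p 0 0 <= x + s ->
    (z = y \/ z = y + s) ->
    exists2 X, conv (map sg (verts Q)) X & dist (sg p) X <= delta Q.
  move=> th1 gth1 hz /andP[hy1 hy2] zE.
  have zb : 1 <= 1 + z ^+ 2 <= 13 / 4.
    have := sqr_ge0 z; case: zE => -> ?; apply/andP; split; nra.
  have hseg : conv [:: mk2 x z; mk2 (x + s) z] (th *: p).
    apply: (inseg _ _ _ (th * p 0 0 - x)); first by apply/andP; split; lra.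
    by apply: row2P; rewrite !mxE /= ?hz; field.
  case: zE => zx.
    apply: (@hull_approx_side x y s (1 + z ^+ 2) x (x + s) (- z) th _ _ (mk2 0 (- 1)) p
      hQ hp _ _ zb _ _ _ _ _ _ _ (gth _ gth1) th1 hseg);
      rewrite ?dot2E ?mk2E; try (by ring); rewrite ?zx ?inE ?eqxx ?orbT //.
    by move=> q; rewrite !inE => /or4P[] /eqP ->; rewrite ?eqxx // dot2E !mk2E; lra.
  apply: (@hull_approx_side x y s (1 + z ^+ 2) x (x + s) z th _ _ (mk2 0 1) p
      hQ hp _ _ zb _ _ _ _ _ _ _ (gth _ gth1) th1 hseg);
      rewrite ?dot2E ?mk2E; try (by ring); rewrite ?zx ?inE ?eqxx ?orbT //.
  by move=> q; rewrite !inE => /or4P[] /eqP ->; rewrite ?eqxx // dot2E !mk2E; lra.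
(* The larger of [t] and [u] belongs to the coordinate that leaves first; at that factor the other
   one is still in range. *)
have [tu|ut] := leP t u.
  have hx : x <= u * p 0 0 <= x + s by apply: ht; rewrite tu.
  case: uE => [ug|uy|uy]; last 2 first.
  - by apply: (horz u y) => //; left.
  - by apply: (horz u (y + s)) => //; right.
  have hy : y <= u * p 0 1 <= y + s by apply: hu; rewrite lexx.
  have [X hX dX] : exists2 X, conv (map sg (verts Q)) X & dist (sg p) X <= chi 2 (d2 Q).
    apply: (@hull_approx_radial R (verts Q) c r (d2 Q) p) => //.
      by move=> w; exact: on_circle.
    rewrite -/K -/V -/g -ug; apply/(sq_conv_box x y _ s0); rewrite !mxE.
    by case/andP: hx => -> ->; case/andP: hy => -> ->.
  by exists X => //; apply: le_trans dX _; rewrite /delta le_max lexx orbT.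
have hy : y <= t * p 0 1 <= y + s by apply: hu; rewrite (ltW ut).
case: tE => [tg|tx|tx].
- by move: ut; rewrite tg ltNge gu.
- by apply: (vert t x) => //; left.
- by apply: (vert t (x + s)) => //; right.
Qed.

Lemma hull_approx Q p : regular_piece Q -> conv (verts Q) p ->
  exists2 X, conv (map sg (verts Q)) X & dist (sg p) X <= delta Q.
Proof.
by case: Q => [a b|x y s|//]; [exact: hull_approx_seg|exact: hull_approx_sq].
Qed.

End Squares.

(** * Replacing points by vertices *)

Section Interpolation.
Variable R : realType.
Implicit Types (p v : 'rV[R]_2) (q : ept R) (Q : piece R).
Local Notation sg := (@sigma_inv_pt R).

Lemma le_maxl (s : seq R) x : x \in s -> x <= maxl s.
Proof.
rewrite /maxl; move: (head 0 s) => z; elim: s => //= y s IH.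
by rewrite inE => /orP[/eqP ->|/IH h]; rewrite le_max ?lexx ?h ?orbT.
Qed.

Lemma minl_le (s : seq R) x : x \in s -> minl s <= x.
Proof.
rewrite /minl; move: (head 0 s) => z; elim: s => //= y s IH.
by rewrite inE => /orP[/eqP ->|/IH h]; rewrite ge_min ?lexx ?h ?orbT.
Qed.

Lemma weighted_min (n : nat) (l f : 'I_n -> R) : (forall i, 0 <= l i) ->
  \sum_i l i = 1 -> exists i, f i <= \sum_j l j * f j.
Proof.
case: n l f => [|n] l f l0 l1.
  by move: l1; rewrite big_ord0 => /eqP; rewrite eq_sym oner_eq0.
exists [arg min_(i < ord0) f i]%O; case: arg_minP => // i _ h.
by rewrite -[f i]mul1r -l1 mulr_suml; apply: ler_sum => j _; rewrite ler_wpM2l ?h.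
Qed.

Lemma conv_mapP (S : seq 'rV[R]_2) X : conv (map sg S) X ->
  exists l : 'I_(size S) -> R, [/\ forall i, 0 <= l i, \sum_i l i = 1 &
    X = \sum_(i < size S) l i *: sg (nth 0 S i)].
Proof.
move=> [l [l0 [l1 ->]]].
have sz : size S = size (map sg S) by rewrite size_map.
have re (V : zmodType) (f : 'I_(size (map sg S)) -> V) :
    \sum_i f i = \sum_(i < size S) f (cast_ord sz i).
  rewrite (reindex (cast_ord sz)) //=.
  by exists (cast_ord (esym sz)) => i _; rewrite ?cast_ordK ?cast_ordKV.
exists (fun i => l (cast_ord sz i)); split=> //; first by rewrite -re.
rewrite re; apply: eq_bigr => i _; congr (_ *: _).
by rewrite (nth_map 0) /=; [|exact: ltn_ord].
Qed.

Lemma hatQE Q : regular_piece Q -> hatQ Q = map sg (verts Q).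
Proof. by case: Q. Qed.

Lemma hat_unit q : dot (hat q) (hat q) = 1.
Proof. by case: q => [v|]; [exact: sigma_unit|exact: dot_north]. Qed.

Lemma nrm_hat q : nrm (hat q) = 1.
Proof. by rewrite /nrm hat_unit sqrtr1. Qed.

Lemma GE k (p q : ept R) : G k p q = (2 + 2 * dot (hat p) (hat q)) ^+ k.
Proof.
rewrite /G [dist _ _]/(nrm _) sqr_nrm; congr (_ ^+ _).
rewrite dotDl !dotDr !dotNl !dotNr !hat_unit (dotC (hat q)); ring.
Qed.

Lemma GC k (p q : ept R) : G k p q = G k q p.
Proof. by rewrite !GE dotC. Qed.

Lemma dot_unit_ge (u v : 'rV[R]_3) : nrm u <= 1 -> nrm v <= 1 -> - 1 <= dot u v.
Proof.
move=> hu hv; have := cauchy_schwarz u v.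
have : nrm u * nrm v <= 1 by rewrite mulr_ile1 ?nrm_ge0.
by move=> h /le_trans/(_ h); rewrite ler_norml => /andP[].
Qed.

Lemma dot_close (u v w : 'rV[R]_3) (e : R) : nrm w = 1 -> dist u v <= e ->
  `|dot u w - dot v w| <= e.
Proof.
move=> w1 uv; have -> : dot u w - dot v w = dot (u - v) w by rewrite !dotE.
by apply: le_trans (cauchy_schwarz _ _) _; rewrite w1 mulr1.
Qed.

(** Puts the finite neighbours of a point and the point at infinity under one predicate. *)
Definition located Q q : Prop :=
  (regular_piece Q /\ exists2 v, q = Some v & conv (verts Q) v) \/ (Q = Inf R /\ q = None).

(** The height 1 - 2/(1 + |p|^2) increases with |p|^2, which is at most the mean over the vertices.
    This serves [dotmax] at [Inf], where there is no [delta] term. *)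
Lemma sigma_height_le (S : seq 'rV[R]_2) p (m : R) : conv S p ->
  (forall v, v \in S -> dot (sg v) (north R) <= m) -> dot (sg p) (north R) <= m.
Proof.
move=> [l [l0 [l1 pE]]] h.
(* Heights never exceed 1; below 1, solving for |p|^2 divides by 1 - m. *)
have [m1|m1] := leP 1 m.
  by apply: le_trans m1; rewrite dot_sigma_north gerBl divr_ge0 // addr_ge0 ?dot_ge0.
have H (t : R) : 0 <= t -> (1 - 2 / (1 + t) <= m) = (t <= 2 / (1 - m) - 1).
  move=> t0; have t1 : 0 < 1 + t by lra.
  rewrite lerBlDr -lerBlDl ler_pdivlMr // [X in _ = X]lerBrDr ler_pdivlMr ?subr_gt0 //.
  by rewrite (addrC t) mulrC.
rewrite dot_sigma_north H ?dot_ge0 //; set z := _ - 1 in H *.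
apply: (@le_trans _ _ (\sum_(i < size S) l i * dot (nth 0 S i) (nth 0 S i))); last first.
  rewrite -[leRHS]mul1r -l1 mulr_suml; apply: ler_sum => i _; rewrite ler_wpM2l //.
  by rewrite -H ?dot_ge0 // -dot_sigma_north h ?mem_nth.
exact: sqnorm_mean_le l0 l1 pE.
Qed.

(** Both points are replaced by nearby hull points, at a cost of [delta] each; on the hulls a
    bilinear form is bounded by its values at vertices. Thus T dominates every base whose power is
    taken. *)
Lemma dotmax_bound Q p Q' q : regular_piece Q -> conv (verts Q) p -> located Q' q ->
  (forall v, v \in verts Q -> dot (sg v) (hat q) <= dotmax Q Q') /\
  dot (sg p) (hat q) <= dotmax Q Q'.
Proof.
move=> hQ hp; case=> [[hQ' [v -> hv]]|[-> ->]]; last first.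
  rewrite /dotmax hatQE // /hat.
  suff H v : v \in verts Q ->
      dot (sg v) (north R) <= maxl [seq dot x (mk3 0 0 1) | x <- map sg (verts Q)].
    by split=> //; exact: sigma_height_le hp H.
  by move=> hv; apply: le_maxl; rewrite -map_comp; exact: (map_f (fun x => dot (sg x) (mk3 0 0 1))).
have -> : dotmax Q Q' = maxl [seq dot x y | x <- hatQ Q, y <- hatQ Q']
    + delta Q + delta Q' + delta Q * delta Q' by case: Q' hQ' {hv}.
rewrite !hatQE //; set m := maxl _.
have [X hX dX] := hull_approx hQ hp; have [Y hY dY] := hull_approx hQ' hv.
have d0 : 0 <= delta Q := le_trans (nrm_ge0 _) dX.
have d0' : 0 <= delta Q' := le_trans (nrm_ge0 _) dY.
have dd0 : 0 <= delta Q * delta Q' by exact: mulr_ge0.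
have H u : u \in map sg (verts Q) -> dot u (sg v) <= m + delta Q'.
  move=> uS; have : dot Y u <= m.
    apply: conv_dot_le hY => w wS; rewrite dotC; apply: le_maxl.
    by apply: allpairs_f.
  have u1 : nrm u = 1 by case/mapP: uS => z _ ->; rewrite nrm_sigma.
  have := dot_close u1 dY; rewrite ler_norml (dotC u) => /andP[_]; lra.
split=> [u hu|]; first by have := H _ (map_f _ hu); rewrite /hat; lra.
have := conv_dot_le H hX; have := dot_close (nrm_sigma v) dX.
rewrite ler_norml /hat => /andP[_]; lra.
Qed.

Lemma vertex_dist_le Q u v : regular_piece Q -> u \in verts Q -> v \in verts Q ->
  dist (sg u) (sg v) <= dQ Q.
Proof.
move=> hQ uQ vQ; have -> : dQ Q = diam (conv (map sg (verts Q))).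
  by rewrite -hatQE //; case: Q hQ {uQ vQ}.
apply: (@dist_le_diam _ _ _ 1); try by apply: conv_mem; exact: map_f.
by move=> z; apply: conv_nrm_le => _ /mapP[x _ ->]; rewrite nrm_sigma.
Qed.

(** The weights are chosen before q and k, so that a single vertex can serve all terms of F. The
    exponent is [k.+1] because the sum in F starts at 1. *)
Lemma vertex_average Q p : regular_piece Q -> conv (verts Q) p ->
  exists l : 'I_(size (verts Q)) -> R, [/\ forall i, 0 <= l i, \sum_i l i = 1 &
   forall Q' q k, located Q' q ->
   `|G k.+1 (Some p) q - \sum_i l i * G k.+1 (Some (nth 0 (verts Q) i)) q| <= eps k.+1 Q Q'].
Proof.
move=> hQ hp; have [X hX dX] := hull_approx hQ hp.
have nX : nrm X <= 1.
  by apply: conv_nrm_le hX => _ /mapP[x _ ->]; rewrite nrm_sigma.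
have [l [l0 l1 XE]] := conv_mapP hX.
exists l; split=> // Q' q k hq.
have [hv hpq] := dotmax_bound hQ hp hq.
have -> : eps k.+1 Q Q' = (k.+1 * k)%N%:R / 2 * (2 + 2 * dotmax Q Q') ^+ (k - 1) * dQ Q ^+ 2
    + 2 * k.+1%:R * (2 + 2 * dotmax Q Q') ^+ k * delta Q.
  by case: Q hQ {hp dX l l0 l1 XE hX hv hpq} => // *; rewrite /eps !subSS !subn0.
set T := 2 + 2 * dotmax Q Q'.
pose y (i : 'I_(size (verts Q))) := 2 + 2 * dot (sg (nth 0 (verts Q) i)) (hat q).
pose m := 2 + 2 * dot X (hat q).
have mE : m = \sum_i l i * y i.
  have two : 2 = \sum_i l i * 2 :> R by rewrite -mulr_suml l1 mul1r.
  rewrite /m XE dot_suml mulr_sumr [X in X + _ = _]two -big_split.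
  by apply: eq_bigr => i _; rewrite /y dotZl /=; ring.
have hq1 := nrm_hat q.
have hy i : 0 <= y i <= T.
  rewrite /y /T; apply/andP; split.
    by have := @dot_unit_ge (sg (nth 0 (verts Q) i)) (hat q); rewrite nrm_sigma hq1 lexx; lra.
  by have := hv _ (mem_nth 0 (ltn_ord i)); lra.
have hd i j : `|y i - y j| <= 2 * dQ Q.
  have -> : y i - y j = 2 * (dot (sg (nth 0 (verts Q) i)) (hat q)
     - dot (sg (nth 0 (verts Q) j)) (hat q)) by rewrite /y; ring.
  rewrite normrM ger0_norm // ler_wpM2l //; apply: dot_close => //.
  by apply: vertex_dist_le => //; exact: mem_nth.
have J := jensen_gap k l0 l1 mE hy hd.
have hm : 0 <= m <= T.
  apply/andP; split; rewrite /m /T.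
    by have := dot_unit_ge nX (_ : nrm (hat q) <= 1); rewrite hq1 => /(_ (lexx _)); lra.
  have : dot X (hat q) <= dotmax Q Q'; last by lra.
  by apply: conv_dot_le hX => _ /mapP[x xQ ->]; exact: hv.
have hP : 0 <= 2 + 2 * dot (sg p) (hat q) <= T.
  apply/andP; split; rewrite /T; last lra.
  by have := @dot_unit_ge (sg p) (hat q); rewrite nrm_sigma hq1 lexx; lra.
have D := pow_diff_le k.+1 hP hm.
have D2 : `|2 + 2 * dot (sg p) (hat q) - m| <= 2 * delta Q.
  have -> : 2 + 2 * dot (sg p) (hat q) - m = 2 * (dot (sg p) (hat q) - dot X (hat q)).
    by rewrite /m; ring.
  by rewrite normrM ger0_norm // ler_wpM2l //; exact: dot_close.
have T0 : 0 <= T by case/andP: hm; exact: le_trans.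
rewrite subSS subn0 in D.
have c0 : 0 <= k.+1%:R * T ^+ k by rewrite mulr_ge0 ?exprn_ge0 ?ler0n.
have {}D := le_trans D (ler_wpM2l c0 D2).
rewrite !GE; under eq_bigr do rewrite GE.
(* Pass through the hull point: the first difference costs the [delta] term, the second is the
   Jensen gap. *)
rewrite [X in X <= _](_ : _ = `|((2 + 2 * dot (sg p) (hat q)) ^+ k.+1 - m ^+ k.+1) +
   (m ^+ k.+1 - \sum_i l i * y i ^+ k.+1)|); last by rewrite addrA subrK.
apply: le_trans (ler_normD _ _) _; rewrite addrC; apply: lerD => //.
by apply: le_trans D _; rewrite le_eqVlt; apply/orP; left; apply/eqP; ring.
Qed.

(** Some vertex does at least as well as the weighted mean. The interpolation bound is two-sided, so
    a coefficient of either sign costs [|a k|]. *)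
Lemma vertex_step (N : nat) (a : nat -> R) (I : finType) (Qs : I -> piece R)
    (qs : I -> ept R) Q p :
  regular_piece Q -> conv (verts Q) p -> (forall j, located (Qs j) (qs j)) ->
  exists2 v, v \in verts Q &
   \sum_(1 <= k < N.+1) a k * \sum_j G k (Some v) (qs j) <=
   \sum_(1 <= k < N.+1) a k * \sum_j G k (Some p) (qs j)
   + \sum_(1 <= k < N.+1) `|a k| * \sum_j eps k Q (Qs j).
Proof.
move=> hQ hp hq; have [l [l0 l1 H]] := vertex_average hQ hp.
pose f i := \sum_(1 <= k < N.+1) a k * \sum_j G k (Some (nth 0 (verts Q) i)) (qs j).
have [i hi] := weighted_min (fun i : 'I_(size (verts Q)) => f i) l0 l1.
exists (nth 0 (verts Q) i); first exact: mem_nth.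
apply: le_trans hi _; rewrite /f.
under eq_bigr do rewrite mulr_sumr.
rewrite exchange_big -big_split /= !big_nat; apply: ler_sum => -[//|k] _.
have -> : \sum_i0 l i0 * (a k.+1 * \sum_j G k.+1 (Some (nth 0 (verts Q) (nat_of_ord i0))) (qs j)) =
   a k.+1 * \sum_j \sum_i0 l i0 * G k.+1 (Some (nth 0 (verts Q) (nat_of_ord i0))) (qs j).
  rewrite exchange_big mulr_sumr; apply: eq_bigr => i0 _ /=.
  by rewrite -mulr_sumr; ring.
rewrite -lerBlDl -mulrBr -sumrB; apply: le_trans (ler_norm _) _.
rewrite normrM ler_wpM2l //; apply: le_trans (ler_norm_sum _ _ _) _.
by apply: ler_sum => j _; rewrite distrC H.
Qed.

Lemma EkE k (p0 p1 p2 p3 : 'rV[R]_2) (g := @G R k) :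
  Ek k (p0, p1, p2, p3) =
  g (Some p0) (Some p1) + g (Some p0) (Some p2) + g (Some p0) (Some p3) + g (Some p0) None
  + (g (Some p1) (Some p2) + g (Some p1) (Some p3) + g (Some p1) None)
  + (g (Some p2) (Some p3) + g (Some p2) None) + g (Some p3) None.
Proof.
rewrite /Ek; under eq_bigr do rewrite big_mkcond.
rewrite !big_ord_recl !big_ord0 /= -/g; ring.
Qed.

Lemma ERRkE k (Q0 Q1 Q2 Q3 : piece R) (e := @eps R k) :
  ERRk k (Q0, Q1, Q2, Q3) =
    (e Q0 Q1 + e Q0 Q2 + e Q0 Q3 + e Q0 (Inf R)) + (e Q1 Q0 + e Q1 Q2 + e Q1 Q3 + e Q1 (Inf R))
  + (e Q2 Q0 + e Q2 Q1 + e Q2 Q3 + e Q2 (Inf R)) + (e Q3 Q0 + e Q3 Q1 + e Q3 Q2 + e Q3 (Inf R)).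
Proof.
rewrite /ERRk; under eq_bigr do rewrite big_mkcond.
rewrite !big_ord_recl !big_ord0 /= -/e; ring.
Qed.

(** Moving one point changes only the four pair terms that contain it, so the total energy [f]
    changes exactly as the sum treated in [vertex_step]. *)
Lemma vertex_step4 (N : nat) (a : nat -> R) Q p Q1 Q2 Q3 (p1 p2 p3 : 'rV[R]_2)
    (f : 'rV[R]_2 -> nat -> R) (e : nat -> R) :
  regular_piece Q -> conv (verts Q) p ->
  located Q1 (Some p1) -> located Q2 (Some p2) -> located Q3 (Some p3) ->
  (forall v k, f v k - f p k =
     G k (Some v) (Some p1) + G k (Some v) (Some p2) + G k (Some v) (Some p3)
     + G k (Some v) None
     - (G k (Some p) (Some p1) + G k (Some p) (Some p2) + G k (Some p) (Some p3)
        + G k (Some p) None)) ->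
  (forall k, e k = eps k Q Q1 + eps k Q Q2 + eps k Q Q3 + eps k Q (Inf R)) ->
  exists2 v, v \in verts Q &
    \sum_(1 <= k < N.+1) a k * f v k <=
    \sum_(1 <= k < N.+1) a k * f p k + \sum_(1 <= k < N.+1) `|a k| * e k.
Proof.
move=> hQ hp h1 h2 h3 hf he.
pose Qs (i : 'I_4) := nth (Inf R) [:: Q1; Q2; Q3; Inf R] i.
pose qs (i : 'I_4) := nth None [:: Some p1; Some p2; Some p3; None] i.
have [|v vQ hv] := @vertex_step N a _ Qs qs Q p hQ hp.
  by case=> -[|[|[|[|]]]] //= i4; rewrite /Qs /qs //=; right.
exists v => //; rewrite -lerBlDl -sumrB; move: hv; rewrite -lerBlDl -sumrB => hv.
have -> : \sum_(1 <= k < N.+1) `|a k| * e k =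
    \sum_(1 <= k < N.+1) `|a k| * \sum_j eps k Q (Qs j).
  apply: eq_bigr => k _; rewrite he !big_ord_recl big_ord0 /Qs /=; ring.
apply: le_trans hv; rewrite le_eqVlt; apply/orP; left; apply/eqP; apply: eq_bigr => k _.
rewrite -!mulrBr hf !big_ord_recl !big_ord0 /qs /=; ring.
Qed.

End Interpolation.

(* F = sum_{k=1}^N a_k G_k, with coefficients a : nat -> R (a_k for 1<=k<=N) *)
Theorem theorem4p9 (R : realType) (N : nat) (a : nat -> R)
    (B : piece R * piece R * piece R * piece R) :
  good_block B ->
  forall v : config R, in_hull_block B v ->
    \sum_(1 <= k < N.+1) a k * Ek k v >=
    minl [seq \sum_(1 <= k < N.+1) a k * Ek k w | w <- vertex_configs B]
    - \sum_(1 <= k < N.+1) `|a k| * ERRk k B.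
Proof.
case: B => [[[Q0 Q1] Q2] Q3] [[s0 [s1 [-> /dyadic_segment_bounds h0]]] hsq].
set Q0' := Seg s0 s1; have {}h0 : regular_piece Q0' by [].
have reg Q : Q = Q1 \/ Q = Q2 \/ Q = Q3 -> regular_piece Q.
  by move/hsq => [x [y [s [-> /good_square_regular]]]].
have h1 := reg Q1 (or_introl erefl).
have h2 := reg Q2 (or_intror (or_introl erefl)).
have h3 := reg Q3 (or_intror (or_intror erefl)).
case=> [[[p0 p1] p2] p3] [c0 [c1 [c2 c3]]].
have loc (Q : piece R) p : regular_piece Q -> conv (verts Q) p -> located Q (Some p).
  by move=> hQ hp; left; split=> //; exists p.
have locv (Q : piece R) p : regular_piece Q -> p \in verts Q -> located Q (Some p).
  by move=> hQ hp; apply: loc => //; exact: conv_mem.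
(* The points are moved one by one; those already moved are vertices and still lie in their hulls.
   In the later steps [GC] puts the moved point first in each pair. *)
have [v0 v0Q F0] := @vertex_step4 R N a Q0' p0 Q1 Q2 Q3 p1 p2 p3
  (fun v k => Ek k (v, p1, p2, p3)) _ h0 c0 (loc _ _ h1 c1) (loc _ _ h2 c2) (loc _ _ h3 c3)
  (fun v k => ltac:(cbv beta; rewrite !EkE; ring)) (fun k => erefl).
have [v1 v1Q F1] := @vertex_step4 R N a Q1 p1 Q0' Q2 Q3 v0 p2 p3
  (fun v k => Ek k (v0, v, p2, p3)) _ h1 c1 (locv _ _ h0 v0Q) (loc _ _ h2 c2) (loc _ _ h3 c3)
  (fun v k => ltac:(cbv beta; rewrite !EkE !(GC k (Some v0)); ring)) (fun k => erefl).
have [v2 v2Q F2] := @vertex_step4 R N a Q2 p2 Q0' Q1 Q3 v0 v1 p3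
  (fun v k => Ek k (v0, v1, v, p3)) _ h2 c2 (locv _ _ h0 v0Q) (locv _ _ h1 v1Q) (loc _ _ h3 c3)
  (fun v k => ltac:(cbv beta; rewrite !EkE !(GC k (Some v0)) !(GC k (Some v1)); ring)) (fun k => erefl).
have [v3 v3Q F3] := @vertex_step4 R N a Q3 p3 Q0' Q1 Q2 v0 v1 v2
  (fun v k => Ek k (v0, v1, v2, v)) _ h3 c3 (locv _ _ h0 v0Q) (locv _ _ h1 v1Q) (locv _ _ h2 v2Q)
  (fun v k => ltac:(cbv beta; rewrite !EkE !(GC k (Some v0)) !(GC k (Some v1)) !(GC k (Some v2)); ring))
  (fun k => erefl).
have hw : (v0, v1, v2, v3) \in vertex_configs (Q0', Q1, Q2, Q3).
  apply/allpairsP; exists ((v0, tt), (v1, (v2, v3))); split=> //=; first exact: (map_f (fun p => (p, tt)) v0Q).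
  by apply/allpairsP; exists (v1, (v2, v3)); split=> //=; apply/allpairsP; exists (v2, v3).
rewrite lerBlDr.
apply: le_trans (minl_le (map_f (fun w => \sum_(1 <= k < N.+1) a k * Ek k w) hw)) _.
have -> : \sum_(1 <= k < N.+1) `|a k| * ERRk k (Q0', Q1, Q2, Q3) =
  \sum_(1 <= k < N.+1) `|a k| * (eps k Q0' Q1 + eps k Q0' Q2 + eps k Q0' Q3 + eps k Q0' (Inf R)) +
  \sum_(1 <= k < N.+1) `|a k| * (eps k Q1 Q0' + eps k Q1 Q2 + eps k Q1 Q3 + eps k Q1 (Inf R)) +
  \sum_(1 <= k < N.+1) `|a k| * (eps k Q2 Q0' + eps k Q2 Q1 + eps k Q2 Q3 + eps k Q2 (Inf R)) +
  \sum_(1 <= k < N.+1) `|a k| * (eps k Q3 Q0' + eps k Q3 Q1 + eps k Q3 Q2 + eps k Q3 (Inf R)).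
  by rewrite -!big_split; apply: eq_bigr => k _; rewrite ERRkE /=; ring.
(* The four inequalities telescope. *)
lra.
Qed.
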